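(* Let $b\in\mathbb{R}$, $b\ne\pm1$, let $\mathbb{T}=\{z\in\mathbb{C}:|z|=1\}$, and let $w(z)=1/|z-b|$ for $z\in\mathbb{T}$. Then the weighted equilibrium measure for this weight on $\mathbb{T}$ is given by $$d\mu_w(e^{it})=\frac{|1-b^2|\,dt}{2\pi(1-2b\cos t+b^2)},\qquad t\in[0,2\pi),$$ and the weighted capacity is $$\mathrm{cap}(\mathbb{T},w)=\frac{1}{|1-b^2|}.$$ Furthermore, any sequence (indexed by $n\geq 2$) of $n$-point weighted Fekete point sets $\{\zeta_k\}_{k=1}^n=\{\zeta_{k,n}\}_{k=1}^n$ for $w$ on $\mathbb{T}$ satisfies $$\tau_n:=\frac1n\sum_{k=1}^n\delta_{\zeta_k}\ \stackrel{*}{\rightarrow}\ \frac{|1-b^2|\,dt}{2\pi(1-2b\cos t+b^2)}\quad\text{on }\mathbb{T}\text{ as }n\to\infty.$$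
   Context: Let $\mathcal{M}(\mathbb{T})$ be the set of positive unit Borel measures supported on $\mathbb{T}$. For $\mu\in\mathcal{M}(\mathbb{T})$ define the weighted energy $$I_w(\mu):=\int\!\!\int\log\frac{1}{|z-t|\,w(z)w(t)}\,d\mu(z)\,d\mu(t)=\int\!\!\int\log\frac{1}{|z-t|}\,d\mu(z)\,d\mu(t)-2\int\log w(t)\,d\mu(t),$$ and let $V_w:=\inf_{\mu\in\mathcal{M}(\mathbb{T})}I_w(\mu)$. The weighted equilibrium measure $\mu_w$ is the unique measure in $\mathcal{M}(\mathbb{T})$ with $I_w(\mu_w)=V_w$, and the weighted capacity is $\mathrm{cap}(\mathbb{T},w):=e^{-V_w}$. For $n\ge2$, an $n$-point weighted Fekete point set for $w$ on $\mathbb{T}$ is a set of $n$ points of $\mathbb{T}$ attaining the supremum $$\delta_n^w(\mathbb{T}):=\sup_{\{z_k\}_{k=1}^n\subset\mathbb{T}}\left(\prod_{1\le j<k\le n}|z_j-z_k|\,w(z_j)w(z_k)\right)^{\frac{2}{n(n-1)}}.$$ $\delta_\zeta$ denotes the unit point mass at $\zeta$, and $\stackrel{*}{\rightarrow}$ denotes weak* convergence of measures. *)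

(* Defs.v *)
From HB Require Import structures.
From mathcomp Require Import all_boot all_order all_algebra.
From mathcomp Require Import complex.
From mathcomp Require Import all_classical all_reals all_analysis.

Set Implicit Arguments.
Unset Strict Implicit.
Unset Printing Implicit Defensive.
Import Order.TTheory GRing.Theory Num.Theory.
Import Normc numFieldNormedType.Exports.
Local Open Scope classical_set_scope.
Local Open Scope complex_scope.
Local Open Scope ring_scope.

(* The complex plane with its Borel sigma-algebra; [R[i]^o] carries the
   topology of the modulus. *)
Definition borelC (R : realType) := g_sigma_algebraType (@open R[i]^o).

Definition unit_circle (R : realType) : set R[i]^o := [set z | normc z = 1].

Definition expi (R : realType) (t : R) : R[i] := cos t +i* sin t.

Section potential_theory.
Variable R : realType.
Implicit Types (w : R[i] -> R) (mu : probability (borelC R) R).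

(* The circle being closed, full mass on it means that the support is in it. *)
Definition circle_measures : set (probability (borelC R) R) :=
  [set mu | mu (@unit_circle R) = 1%E].

(* The kernel is computed in [\bar R], where the inverse of 0 and its [lne]
   are [+oo]: it takes the value [+oo] on the diagonal. *)
Definition weighted_kernel w (z t : R[i]) : \bar R :=
  lne ((normc (z - t) * w z * w t)%:E^-1)%E.

Definition weighted_energy w mu : \bar R :=
  (\int[mu]_(z in @unit_circle R) \int[mu]_(t in @unit_circle R)
     weighted_kernel w z t)%E.

Definition robin_constant w : \bar R :=
  ereal_inf [set weighted_energy w mu | mu in circle_measures].

Definition weighted_capacity w : \bar R := expeR (- robin_constant w)%E.

Definition is_equilibrium_measure w mu : Prop :=
  [/\ circle_measures mu,
      weighted_energy w mu = robin_constant w &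
      forall nu, circle_measures nu -> weighted_energy w nu = robin_constant w ->
        forall A : set (borelC R), measurable A -> nu A = mu A].

Definition fekete_product w n (z : n.-tuple R[i]) : R :=
  (\prod_(j < n) \prod_(k < n | (j < k)%N)
     (normc (tnth z j - tnth z k) * w (tnth z j) * w (tnth z k)))
  `^ (2 / (n%:R * (n%:R - 1))).

Definition on_circle n (z : n.-tuple R[i]) : Prop :=
  forall k, unit_circle (tnth z k).

(* Tuples with repeated entries contribute 0 to this supremum. *)
Definition fekete_sup w n : R :=
  sup [set fekete_product w z | z in [set z : n.-tuple R[i] | on_circle z]].

Definition is_fekete w n (z : n.-tuple R[i]) : Prop :=
  [/\ on_circle z, uniq z & fekete_product w z = fekete_sup w n].

Definition empirical_measure n (z : n.-tuple R[i]) :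
    {measure set (borelC R) -> \bar R} :=
  mscale (n%:R^-1)%:nng
    (msum (fun k : nat => dirac (nth 0 z k : borelC R)) n).

(* Real test functions, which suffice for complex ones. Only the values of [f]
   on the circle matter. *)
Definition weak_star_cvg (nu_ : nat -> {measure set (borelC R) -> \bar R})
    (nu : {measure set (borelC R) -> \bar R}) : Prop :=
  forall f : R[i]^o -> R, {within @unit_circle R, continuous f} ->
    (\int[nu_ n]_(z in @unit_circle R) (f z)%:E)%E @[n --> \oo] -->
    (\int[nu]_(z in @unit_circle R) (f z)%:E)%E.

(* d nu(e^{it}) = g(t) dt, t in [0, 2 pi) *)
Definition has_angular_density
    (nu : {measure set (borelC R) -> \bar R}) (g : R -> R) : Prop :=
  forall A : set (borelC R), measurable A ->
    nu A = (\int[lebesgue_measure]_(t in `[0%R, (2 * pi)%R[ `&` @expi R @^-1` A)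
              (g t)%:E)%E.

End potential_theory.

(* Main.v *)
Require Import Defs.
From HB Require Import structures.
From mathcomp Require Import all_boot all_order all_algebra.
From mathcomp Require Import complex.
From mathcomp Require Import all_classical all_reals all_analysis.
From mathcomp Require Import ring lra measurable_realfun.

Set Implicit Arguments.
Unset Strict Implicit.
Unset Printing Implicit Defensive.
Import Order.TTheory GRing.Theory Num.Theory.
Import Normc numFieldNormedType.Exports.
Local Open Scope classical_set_scope.
Local Open Scope complex_scope.
Local Open Scope ring_scope.

(** The weight is removed by a Moebius map. The involution
    [phi z = (b z - 1) / (z - b)] preserves the circle [T] and satisfies
    [|phi z - phi t| = |1 - b^2| |z - t| w(z) w(t)] there ([normc_mobiusB]). So
    the weighted energy of [mu] is [ln |1 - b^2|] plus the logarithmic energy of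
    the image of [mu] under [phi], and the weighted Fekete problem is the
    classical one for the images of the points. On the unweighted circle the
    equilibrium measure is the uniform one, with energy 0, and Fekete points
    compete with the roots of unity.

    The classical problem is solved with Fourier coefficients. For unit [v], [u]
    and [0 < r < 1] the cosine law and the Taylor series of the logarithm give
    [- ln |v - u| >= ln r / 2 + sum_k r^k Re (q^k) / k] with [q = v u^*]
    ([ln_dist_lower]).
    Integrated twice, the right-hand side is [ln r / 2] plus a sum of squares of
    the moments of [phi], that is of the integrals of [Re phi^k] and [Im phi^k].
    Letting [r] tend to 1, the weighted energy is at least [ln |1 - b^2|]
    ([weighted_energy_ge]), and a measure that attains this value has vanishing
    moments ([minimizer_moments0]). Conversely, if the moments vanish then so
    does the potential of the image measure inside the disc, and Fatou's lemma
    gives the opposite inequality ([weighted_energy_le]).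

    The measure of the theorem has vanishing moments because its density is, up
    to a constant, the angular velocity of [phi (e^(it))]: its product with
    [phi^k] is the derivative of a periodic function
    ([integral_poisson_moment]). Its mass is computed from an explicit primitive
    ([integral_poisson_density]).

    Moments determine everything else, since trigonometric polynomials in [phi]
    are uniformly dense in the continuous functions on [T] ([trig_dense],
    [weyl_criterion]). This gives uniqueness of the minimizer
    ([measure_eq_of_mean]). For Fekete points the same lower bound of the kernel
    is summed over pairs ([discrete_moment_bound]): their product of distances is
    at least that of the roots of unity, hence at least 1
    ([fekete_image_large]), which forces the moments of the empirical measures
    to tend to 0 ([fekete_moments_cvg]). *)

Local Notation Re := (@complex.Re _).
Local Notation Im := (@complex.Im _).

(** * Modulus and conjugation on the circle *)

Section complex_modulus.
Variable R : realType.
Implicit Types (z u v : R[i]).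

Lemma normcE z : normc z = Num.sqrt (Re z ^+ 2 + Im z ^+ 2).
Proof. by case: z. Qed.

Lemma sqr_normc z : normc z ^+ 2 = Re z ^+ 2 + Im z ^+ 2.
Proof. by rewrite normcE sqr_sqrtr // addr_ge0 ?sqr_ge0. Qed.

Lemma normc_ge0 z : 0 <= normc z.
Proof. by rewrite normcE sqrtr_ge0. Qed.

Lemma normc_eq0 z : (normc z == 0) = (z == 0).
Proof.
by apply/eqP/eqP => [/eq0_normc //|->]; rewrite normcE /= !expr0n addr0 sqrtr0.
Qed.

Lemma normc_gt0 z : (0 < normc z) = (z != 0).
Proof. by rewrite lt_def normc_eq0 normc_ge0 andbT. Qed.

Lemma normc_conj z : normc z^*%C = normc z.
Proof. by rewrite !normcE; case: z => x y /=; rewrite sqrrN. Qed.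

Lemma normcX z n : normc (z ^+ n) = normc z ^+ n.
Proof.
elim: n => [|n IH]; first by rewrite !expr0; exact: normc1.
by rewrite !exprS normcM IH.
Qed.

Lemma normc_real (x : R) : normc x%:C = `|x|.
Proof. by rewrite /= expr0n addr0 sqrtr_sqr. Qed.

Lemma normr_normc z : `|z| = (normc z)%:C.
Proof. by []. Qed.

Lemma ler_Re_normc z : `|Re z| <= normc z.
Proof. by rewrite normcE -sqrtr_sqr ler_wsqrtr // lerDl sqr_ge0. Qed.

Lemma ler_Im_normc z : `|Im z| <= normc z.
Proof. by rewrite normcE -sqrtr_sqr ler_wsqrtr // lerDr sqr_ge0. Qed.

Lemma ReM z u : Re (z * u) = Re z * Re u - Im z * Im u.
Proof. by case: z; case: u. Qed.
Lemma ImM z u : Im (z * u) = Re z * Im u + Im z * Re u.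
Proof. by case: z; case: u. Qed.
Lemma Re_conj z : Re z^*%C = Re z. Proof. by case: z. Qed.
Lemma Im_conj z : Im z^*%C = - Im z. Proof. by case: z. Qed.

Lemma complex_eqP z u : Re z = Re u -> Im z = Im u -> z = u.
Proof. by case: z; case: u => a b c d /= -> ->. Qed.

Lemma conjcB z u : (z - u)^*%C = z^*%C - u^*%C. Proof. exact: rmorphB. Qed.
Lemma conjcM z u : (z * u)^*%C = z^*%C * u^*%C. Proof. exact: rmorphM. Qed.
Lemma conjcX z n : (z ^+ n)^*%C = z^*%C ^+ n. Proof. exact: rmorphXn. Qed.

Lemma unit_mul_conj z : normc z = 1 -> z * z^*%C = 1.
Proof.
move=> z1; have := sqr_normc z; rewrite z1 expr1n => e.
apply: complex_eqP; rewrite ?ReM ?ImM Re_conj Im_conj /=; last by ring.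
by rewrite e; ring.
Qed.

Lemma unit_Re_Im z : normc z = 1 -> Re z ^+ 2 + Im z ^+ 2 = 1.
Proof. by rewrite -sqr_normc => ->; rewrite expr1n. Qed.

(** The cosine law behind all comparisons of [log |v - u|] with its
    regularization inside the disc. *)
Lemma normc_one_sub_conj (r : R) v u : normc v = 1 -> normc u = 1 ->
  normc (1 - r%:C * (v * u^*%C)) ^+ 2 = (1 - r) ^+ 2 + r * normc (v - u) ^+ 2.
Proof.
move=> /unit_Re_Im hv /unit_Re_Im hu; rewrite !sqr_normc.
move: v u hv hu => [a b] [c d] /= hv hu.
transitivity (1 - 2 * r * (a * c + b * d)
   + r ^+ 2 * ((a ^+ 2 + b ^+ 2) * (c ^+ 2 + d ^+ 2))); first by ring.
transitivity ((1 - r) ^+ 2 + r * ((a ^+ 2 + b ^+ 2) + (c ^+ 2 + d ^+ 2)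
   - 2 * (a * c + b * d))); last by ring.
by rewrite hv hu; ring.
Qed.

Lemma normcB_le_unit v u : normc v = 1 -> normc u = 1 -> normc (v - u) <= 2.
Proof. by move=> v1 u1; rewrite (le_trans (le_normcD _ _)) // normcN v1 u1. Qed.

Lemma normcB z u : normc (z - u) = normc (u - z).
Proof. by rewrite -normcN opprB. Qed.

End complex_modulus.

Arguments normc {R} x : simpl never.

(** * The circle map that removes the weight *)

(** Up to sign, an automorphism of the unit disc when [|b| > 1] and the
    reciprocal of one when [|b| < 1]. With this sign it is an involution. *)
Definition mobius (R : realType) (b : R) (z : R[i]) : R[i] :=
  (b%:C * z - 1) / (z - b%:C).

Section mobius.
Variables (R : realType) (b : R).
Hypotheses (hb1 : b != 1) (hbN1 : b != -1).
Implicit Types (z t : R[i]).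

Lemma one_sub_sqr_neq0 : 1 - b ^+ 2 != 0.
Proof.
by rewrite subr_eq0 eq_sym sqrf_eq1 negb_or hb1.
Qed.

Lemma circle_neq_real z : normc z = 1 -> z - b%:C != 0.
Proof.
move=> z1; apply/eqP => /subr0_eq zb; move: z1; rewrite zb normc_real.
by case: (ler0P b) => _ e; [move: hbN1|move: hb1]; rewrite -e ?opprK eqxx.
Qed.

Lemma normc_mobius z : normc z = 1 -> normc (mobius b z) = 1.
Proof.
move=> z1; have zb := circle_neq_real z1.
rewrite /mobius normcM normcV.
suff -> : normc (b%:C * z - 1) = normc (z - b%:C) by rewrite divff// normc_eq0.
rewrite -[RHS]normc_conj -[RHS]mul1r -[in RHS]z1 -normcM.
by rewrite conjcB mulrBr unit_mul_conj // conjc_real normcB mulrC.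
Qed.

(** The weighted kernel of [z] and [t] is thus, up to the constant
    [ln |1 - b^2|], the unweighted one of their images: this reduces everything
    to the classical problem on the circle. *)
Lemma normc_mobiusB z t : normc z = 1 -> normc t = 1 ->
  normc (mobius b z - mobius b t) =
  `|1 - b ^+ 2| * (normc (z - t) * (1 / normc (z - b%:C)) *
                   (1 / normc (t - b%:C))).
Proof.
move=> /circle_neq_real zb /circle_neq_real tb.
have -> : mobius b z - mobius b t =
    (1 - b ^+ 2)%:C * (z - t) / (z - b%:C) / (t - b%:C).
  rewrite /mobius rmorphB rmorphXn /= rmorph1; field.
  by rewrite zb tb.
by rewrite !normcM !normcV normc_real; field; rewrite !normc_eq0 zb tb.
Qed.

Lemma mobiusK z : normc z = 1 -> mobius b (mobius b z) = z.
Proof.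
move=> z1; have zb := circle_neq_real z1.
have h : (b%:C ^+ 2 - 1 : R[i]) != 0.
  rewrite -oppr_eq0 opprB -rmorphXn -(rmorph1 (real_complex R)) -rmorphB.
  by rewrite fmorph_eq0 one_sub_sqr_neq0.
rewrite {1}/mobius.
have -> : mobius b z - b%:C = (b%:C ^+ 2 - 1) / (z - b%:C).
  by rewrite /mobius; field.
have -> : b%:C * mobius b z - 1 = (b%:C ^+ 2 - 1) * z / (z - b%:C).
  by rewrite /mobius; field.
by field; rewrite h zb.
Qed.

End mobius.

(** * Fourier series of the logarithmic kernel *)

Section log_series.
Variable R : realType.
Implicit Types (u v : R[i]) (s r : R).

Lemma sqr_normc_one_sub u s :
  normc u = 1 -> normc (1 - s%:C * u) ^+ 2 = 1 - 2 * s * Re u + s ^+ 2.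
Proof.
move=> /unit_Re_Im; case: u => x y /= e; rewrite sqr_normc /=.
transitivity (1 - 2 * s * x + s ^+ 2 * (x ^+ 2 + y ^+ 2)); first by ring.
by rewrite e mulr1.
Qed.

Lemma normc_one_sub_ge u s : normc u = 1 -> 0 <= s -> 1 - s <= normc (1 - s%:C * u).
Proof.
move=> u1 s0; rewrite lerBlDr.
rewrite -[X in _ <= _ + X]mulr1 -[X in _ <= _ + _ * X]u1.
rewrite -[X in _ <= _ + X * _](ger0_norm s0) -normc_real -normcM.
by apply: le_trans (le_normcD _ _); rewrite subrK normc1.
Qed.

(** Geometric sum: the remainder of the differentiated series is
    [s^K u^(K+1) / (1 - s u)]. *)
Lemma geometric_Re u s K : normc u = 1 ->
  normc (1 - s%:C * u) ^+ 2 * \sum_(k < K) s ^+ k * Re (u ^+ k.+1) =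
  Re u - s - s ^+ K * Re (u ^+ K.+1 * (1 - s%:C * u)^*%C).
Proof.
move=> u1; have e := unit_Re_Im u1; elim: K => [|K IH].
  rewrite big_ord0 mulr0 expr0 mul1r expr1.
  case: u u1 e => x y /= _ e.
  have e' : y ^+ 2 = 1 - x ^+ 2 by rewrite -e; ring.
  by ring: e'.
rewrite big_ord_recr /= mulrDr IH sqr_normc (exprS s) (exprS u K.+1).
move: (u ^+ K.+1) e {u1 IH} => [a b]; case: u => x y /= e.
have e' : y ^+ 2 = 1 - x ^+ 2 by rewrite -e; ring.
by ring: e'.
Qed.

(** [- ln |1 - r u|] and its Taylor polynomial in [r] agree at [r = 0]; the mean
    value theorem turns the bound on the derivative of their difference into
    this one. *)
Lemma log_series_remainder u r K : normc u = 1 -> 0 <= r -> r < 1 ->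
  `| - ln (normc (1 - r%:C * u)) -
     \sum_(k < K) r ^+ k.+1 / k.+1%:R * Re (u ^+ k.+1) | <= r ^+ K.+1 / (1 - r).
Proof.
move=> u1 r0 r1.
pose D (s : R) : R := 1 - 2 * s * Re u + s ^+ 2.
pose F := ((- 2^-1) \*: (@ln R \o D)) -
  \sum_(k < K) (fun s : R => s ^+ k.+1 / k.+1%:R * Re (u ^+ k.+1)).
have FE s : F s = - 2^-1 * ln (D s) -
    \sum_(k < K) s ^+ k.+1 / k.+1%:R * Re (u ^+ k.+1).
  by rewrite /F fctE; congr (_ - _); rewrite fct_sumE.
pose dF (s : R) : R := (Re u - s) / D s - \sum_(k < K) s ^+ k * Re (u ^+ k.+1).
have D_gt0 s : 0 <= s -> s < 1 -> 0 < D s.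
  move=> s0 s1; rewrite /D -sqr_normc_one_sub // exprn_gt0 //.
  by rewrite (lt_le_trans _ (normc_one_sub_ge u1 s0)) // subr_gt0.
have derF s : 0 <= s -> s < 1 -> is_derive s 1 F (dF s).
  move=> s0 s1.
  have dD : is_derive s 1 D (- 2 * Re u + 2 * s).
    rewrite /D; apply: is_derive_eq.
    by rewrite /GRing.scale /=; ring.
  have dlnD := @is_derive1_comp _ (@ln R) D s _ _ (is_derive1_ln (D_gt0 _ s0 s1)) dD.
  have dsum : is_derive s 1
      (\sum_(k < K) (fun s : R => s ^+ k.+1 / k.+1%:R * Re (u ^+ k.+1)))
      (\sum_(k < K) s ^+ k * Re (u ^+ k.+1)).
    apply: is_derive_sum => k.
    have -> : (fun s : R => s ^+ k.+1 / k.+1%:R * Re (u ^+ k.+1)) =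
        (Re (u ^+ k.+1) / k.+1%:R) *: ((@id R) ^+ k.+1).
      apply/funext => x.
      rewrite scalrfctE exprfctE /GRing.scale /=; by ring.
    apply: is_derive_eq (is_deriveZ _ (is_deriveX k.+1 (is_derive_id s 1))) _.
    by rewrite /GRing.scale /=; field.
  have h := is_deriveB (is_deriveZ (- 2^-1) dlnD) dsum.
  apply: is_derive_eq h _.
  rewrite /dF; congr (_ - _); rewrite /GRing.scale /=; field.
  exact/lt0r_neq0/D_gt0.
have Fr : F r - F 0 = - ln (normc (1 - r%:C * u)) -
     \sum_(k < K) r ^+ k.+1 / k.+1%:R * Re (u ^+ k.+1).
  rewrite !FE /D -!sqr_normc_one_sub //.
  have -> : - 2^-1 * ln (normc (1 - 0%:C * u) ^+ 2) = 0.
    by rewrite mul0r subr0 normc1 expr1n ln1 mulr0.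
  rewrite [X in _ - (0 - X)]big1 ?subrr ?subr0; last first.
    by move=> k _; rewrite expr0n /= !mul0r.
  congr (_ - _); rewrite lnXn; last first.
    by rewrite (lt_le_trans _ (normc_one_sub_ge u1 r0)) // subr_gt0.
  by rewrite mulr2n; field.
rewrite -Fr.
have [||c] := @MVT_segment _ F dF 0 r r0.
- move=> c; rewrite in_itv /= => /andP[c0 cr].
  by apply: derF; [exact: ltW|exact: lt_trans r1].
- apply: derivable_within_continuous => c; rewrite in_itv /= => /andP[c0 cr].
  have [] := derF c c0 (le_lt_trans cr r1) => //.
rewrite in_itv /= => /andP[c0 cr] ->; rewrite subr0.
have c1 := le_lt_trans cr r1.
have -> : dF c = c ^+ K * Re (u ^+ K.+1 * (1 - c%:C * u)^*%C) / D c.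
  have := geometric_Re c K u1; rewrite sqr_normc_one_sub // -/(D c) => e.
  have Dc := lt0r_neq0 (D_gt0 c c0 c1).
  apply: (mulfI Dc); rewrite /dF mulrBr e; field.
  exact: Dc.
rewrite !normrM normfV (ger0_norm (exprn_ge0 K c0)) (ger0_norm r0).
rewrite (ger0_norm (ltW (D_gt0 c c0 c1))).
have n0 : 0 < normc (1 - c%:C * u).
  by rewrite (lt_le_trans _ (normc_one_sub_ge u1 c0)) // subr_gt0.
rewrite /D -sqr_normc_one_sub //.
have -> : r ^+ K.+1 / (1 - r) = r ^+ K * (1 - r)^-1 * r by rewrite exprS; ring.
apply: ler_wpM2r => //.
rewrite -mulrA; apply: ler_pM; rewrite ?exprn_ge0 ?mulr_ge0 ?invr_ge0 ?exprn_ge0 //.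
- exact: ltW.
- by apply: lerXn2r; rewrite // nnegrE.
rewrite ler_pdivrMr ?exprn_gt0 //.
apply: le_trans (ler_Re_normc _) _.
rewrite normcM normc_conj normcX u1 expr1n mul1r expr2 mulrA.
apply: ler_peMl; first exact: ltW.
rewrite ler_pdivlMl ?subr_gt0 // mulr1.
by apply: le_trans (normc_one_sub_ge u1 c0); rewrite lerB.
Qed.

(** By the cosine law [|1 - r v u^*|^2] is at least [r |v - u|^2]: moving one
    point inside the disc costs at most [- ln r / 2]. *)
Lemma ln_dist_regularized v u r : normc v = 1 -> normc u = 1 -> v != u -> 0 < r ->
  2^-1 * ln r + - ln (normc (1 - r%:C * (v * u^*%C))) <= - ln (normc (v - u)).
Proof.
move=> v1 u1 vu r0.
have d0 : 0 < normc (v - u) by rewrite normc_gt0 subr_eq0.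
have e := normc_one_sub_conj r v1 u1.
have h : r * normc (v - u) ^+ 2 <= normc (1 - r%:C * (v * u^*%C)) ^+ 2.
  by rewrite e lerDr sqr_ge0.
have D0 : 0 < normc (1 - r%:C * (v * u^*%C)).
  rewrite lt_def normc_ge0 andbT; apply/eqP => D0; move: h.
  by rewrite D0 expr0n /= leNgt mulr_gt0 ?exprn_gt0.
move: h; rewrite -ler_ln ?posrE ?mulr_gt0 ?exprn_gt0 //.
rewrite lnM ?posrE ?exprn_gt0 // !lnXn //.
by lra.
Qed.

(** The form of the kernel in which both the continuous and the discrete energy
    are bounded below: constants plus a finite sum of positive definite
    kernels. *)
Lemma ln_dist_lower v u r K : normc v = 1 -> normc u = 1 -> v != u -> 0 < r -> r < 1 ->
  2^-1 * ln r + \sum_(k < K) r ^+ k.+1 / k.+1%:R * Re ((v * u^*%C) ^+ k.+1)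
    - r ^+ K.+1 / (1 - r) <= - ln (normc (v - u)).
Proof.
move=> v1 u1 vu r0 r1.
have vu1 : normc (v * u^*%C) = 1 by rewrite normcM normc_conj v1 u1 mulr1.
have := ln_dist_regularized v1 u1 vu r0.
have := log_series_remainder K vu1 (ltW r0) r1.
by rewrite ler_norml => /andP[+ _]; lra.
Qed.

End log_series.

(** * Topology of the circle *)

Section circle_topology.
Variable R : realType.
Implicit Types (z w u v : R[i]) (r e : R).
Notation T := (@unit_circle R).

(** Balls in [R[i]^o] have their radius in [R[i]], where being positive includes
    being real. *)
Lemma nbhs_complexP (z : R[i]^o) (A : set R[i]^o) :
  nbhs z A <-> exists2 r : R, 0 < r & forall w, normc (z - w) < r -> A w.
Proof.
split=> [/nbhs_ballP[e /= e0 zeA]|[r r0 zrA]].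
  move: e0 zeA; case: e => x y; rewrite ltcE /= => /andP[/eqP -> x0] zeA.
  exists x => // w zw; apply: zeA.
  by rewrite -ball_normE /ball_ /= normr_normc ltcR.
apply/nbhs_ballP; exists (r%:C) => /=; first by rewrite ltcR.
by move=> w; rewrite -ball_normE /ball_ /= normr_normc ltcR => /zrA.
Qed.

Lemma lipschitz_continuous_complex (f : R[i]^o -> R) :
  (forall z w, `|f z - f w| <= normc (z - w)) -> continuous f.
Proof.
move=> fL z; apply/(@cvgrPdist_lt _ _ _ (nbhs (z : R[i]^o))) => e e0.
apply/nbhs_complexP; exists e => // w.
exact: le_lt_trans.
Qed.

Lemma continuous_Re : continuous (Re : R[i]^o -> R).
Proof.
apply: lipschitz_continuous_complex => z w; apply: le_trans (ler_Re_normc _).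
by case: z; case: w.
Qed.

Lemma continuous_Im : continuous (Im : R[i]^o -> R).
Proof.
apply: lipschitz_continuous_complex => z w; apply: le_trans (ler_Im_normc _).
by case: z; case: w.
Qed.

Lemma continuous_normc : continuous (@normc R : R[i]^o -> R).
Proof.
apply: lipschitz_continuous_complex => z w.
have h x y : normc x - normc y <= normc (x - y).
  by rewrite lerBlDr (le_trans _ (le_normcD _ _)) ?subrK.
by rewrite ler_norml lerNl opprB h andbT normcB h.
Qed.

Lemma cvg_complex (S : topologicalType) (F : set_system S) (FF : Filter F)
  (f : S -> R[i]^o) (l : R[i]^o) :
  (fun x => Re (f x)) x @[x --> F] --> Re l ->
  (fun x => Im (f x)) x @[x --> F] --> Im l -> f x @[x --> F] --> l.
Proof.
move=> /cvgrPdist_lt fR /cvgrPdist_lt fI A /nbhs_complexP[r r0 rA].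
have r2 : 0 < r / 2 by rewrite divr_gt0.
suff : \forall x \near F, A (f x) by [].
near=> x; apply: rA.
have hR : `|Re l - Re (f x)| < r / 2 by near: x; exact: fR.
have hI : `|Im l - Im (f x)| < r / 2 by near: x; exact: fI.
have -> : l - f x = (Re l - Re (f x))%:C + (Im l - Im (f x)) *i.
  by case: (l) => a b; case: (f x) => c d; apply: complex_eqP => /=; ring.
apply: le_lt_trans (le_normcD _ _) _.
rewrite normc_real [X in _ + X]normcE /= expr0n add0r sqrtr_sqr.
by rewrite (splitr r) ltrD.
Unshelve. all: by end_near. Qed.

Lemma continuous_expi : continuous (@expi R : R -> R[i]^o).
Proof.
by move=> t; apply: cvg_complex => /=; [exact: continuous_cos|exact: continuous_sin].
Qed.

Lemma closed_circle : closed T.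
Proof.
have -> : T = (@normc R : R[i]^o -> R) @^-1` [set 1] by [].
apply: preimage_closed; last exact/accessible_closed_set1/hausdorff_accessible/Rhausdorff.
by move=> z _; exact: continuous_normc.
Qed.

Lemma normc_expi (t : R) : normc (expi t) = 1.
Proof. by rewrite normcE /= cos2Dsin2 sqrtr1. Qed.

Lemma expi_surj z : normc z = 1 -> exists2 t, t \in `[0, 2 * pi] & expi t = z.
Proof.
move=> /unit_Re_Im; case: z => x y /= xy.
have x1 : -1 <= x <= 1.
  rewrite -ler_norml -(@ler_pXn2r _ 2) ?nnegrE // expr1n real_normK ?num_real //.
  by rewrite -xy lerDl sqr_ge0.
have xi : x \in `[-1, 1]%R by rewrite in_itv.
have y2 : y ^+ 2 = 1 - x ^+ 2 by rewrite -xy; ring.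
have := acos_ge0 xi; have := acos_lepi xi => a1 a0; have p0 := pi_gt0 R.
have [y0|y0] := leP 0 y.
  exists (acos x); first by rewrite in_itv /=; lra.
  by rewrite /expi acosK // sin_acos // -y2 sqrtr_sqr ger0_norm.
exists (2 * pi - acos x); first by rewrite in_itv /=; lra.
rewrite /expi cosB sinB (mulr_natl pi 2) cos2pi sin2pi acosK // sin_acos // -y2.
rewrite sqrtr_sqr ltr0_norm //.
by congr Complex; ring.
Qed.

Lemma compact_circle : compact T.
Proof.
have -> : T = (@expi R : R -> R[i]^o) @` `[0, 2 * pi].
  apply/seteqP; split=> z /=.
    by move=> /expi_surj[t tI <-]; exists t.
  by move=> [t _ <-]; exact: normc_expi.
apply: continuous_compact; last exact: segment_compact.
exact/continuous_subspaceT/continuous_expi.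
Qed.

Lemma within_circleP (f : R[i]^o -> R) : {within T, continuous f} ->
  forall z, normc z = 1 -> forall e, 0 < e -> exists2 d, 0 < d &
    forall w, normc w = 1 -> normc (z - w) < d -> `|f z - f w| < e.
Proof.
move=> cf z z1 e e0.
have : within T (nbhs (z : R[i]^o)) (fun w => `|f z - f w| < e).
  rewrite nbhs_subspace_in //.
  by have /(@cvgrPdist_lt _ _ _ (nbhs (z : subspace T))) := cf z; apply.
move=> /nbhs_complexP[d d0 h].
by exists d => // w w1 zw; apply: h.
Qed.

Lemma circle_uniformly_continuous (f : R[i]^o -> R) :
  {within T, continuous f} -> forall e, 0 < e -> exists2 d, 0 < d &
    forall z w, normc z = 1 -> normc w = 1 -> normc (z - w) < d ->
      `|f z - f w| < e.
Proof.
move=> cf e e0.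
have /compact_near_coveringP /near_covering_withinP := compact_circle.
move=> /(_ R (0 : R)^'+ (fun d z => forall w, normc w = 1 -> normc (z - w) < d ->
      `|f z - f w| < e)) [].
  move=> z z1.
  have [d d0 dP] := within_circleP cf z1 (divr_gt0 e0 (ltr0n R 2)).
  have d2 : 0 < d / 2 by rewrite divr_gt0.
  exists ([set z' | normc (z - z') < d / 2], [set r | r < d / 2]).
    split => /=; first by apply/nbhs_complexP; exists (d / 2).
    exact: nbhs_right_lt.
  move=> [z' r] /= [zz' rd] z'1 w w1 z'w.
  rewrite (splitr e) -(subrK (f z) (f z')) -addrA.
  apply: le_lt_trans (ler_normD _ _) _; apply: ltrD.
    rewrite distrC; apply: dP => //; lra.
  apply: dP => //; rewrite -(subrK z' z) -addrA.
  by apply: le_lt_trans (le_normcD _ _) _; lra.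
move=> d /= d0 h; exists (d / 2); first by rewrite divr_gt0.
move=> z w z1 w1 zw; apply: (h (d / 2)) => //=; last by rewrite divr_gt0.
rewrite sub0r normrN gtr0_norm ?divr_gt0 //; lra.
Qed.

End circle_topology.

(** * Means of continuous functions on the circle *)

Section circle_mean.
Variable R : realType.
Notation T := (@unit_circle R).
Notation CT f := ({within T, continuous f}).
Implicit Types (f g : R[i]^o -> R) (nu : {measure set (borelC R) -> \bar R}).

Lemma circle_continuous_cst (c : R) : CT (fun=> c : R).
Proof. by move=> z; exact: cvg_cst. Qed.

Lemma circle_continuousD f g : CT f -> CT g -> CT (fun z => f z + g z).
Proof. by move=> cf cg z; apply: cvgD; [exact: cf|exact: cg]. Qed.

Lemma circle_continuousB f g : CT f -> CT g -> CT (fun z => f z - g z).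
Proof. by move=> cf cg z; apply: cvgB; [exact: cf|exact: cg]. Qed.

Lemma circle_continuousM f g : CT f -> CT g -> CT (fun z => f z * g z).
Proof. by move=> cf cg z; apply: cvgM; [exact: cf|exact: cg]. Qed.

Lemma circle_continuous_sum (I : Type) (s : seq I) (F : I -> R[i]^o -> R) :
  (forall i, CT (F i)) -> CT (fun z => \sum_(i <- s) F i z).
Proof.
move=> cF; elim: s => [|i s IH].
  rewrite [X in CT X](_ : _ = fun=> 0); first exact: circle_continuous_cst.
  by apply/funext => z; rewrite big_nil.
rewrite [X in CT X](_ : _ = fun z => F i z + \sum_(j <- s) F j z).
  exact: circle_continuousD.
by apply/funext => z; rewrite big_cons.
Qed.

Lemma circle_continuous_comp (U : topologicalType) (h : R[i]^o -> U) (g : U -> R) :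
  CT h -> continuous g -> CT (fun z => g (h z)).
Proof.
move=> ch cg z; apply: (@cvg_comp _ _ _ h g _ (nbhs (h z))); first exact: ch.
exact: cg.
Qed.

Lemma circle_continuousX (h : R[i]^o -> R[i]^o) k : CT h ->
  CT ((fun z => (h z : R[i]) ^+ k) : R[i]^o -> R[i]^o).
Proof.
move=> ch; elim: k => [|k IH] z.
  rewrite [X in continuous_at _ X](_ : _ = fun=> 1 : R[i]^o); first exact: cvg_cst.
  by apply/funext => w; rewrite /from_subspace expr0.
rewrite [X in continuous_at _ X](_ : _ = fun w => (h w : R[i]^o) * (h w : R[i]^o) ^+ k).
  by apply: cvgM; [exact: ch|exact: IH].
by apply/funext => w; rewrite /from_subspace exprS.
Qed.

Lemma measurable_circle : measurable (T : set (borelC R)).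
Proof.
rewrite -(setCK (T : set (borelC R))); apply: measurableC.
apply: sub_sigma_algebra; exact/closed_openC/closed_circle.
Qed.

Lemma circle_continuous_measurable f :
  CT f -> measurable_fun (T : set (borelC R)) (f : borelC R -> R).
Proof.
move=> /continuousP cf; apply: (measurability _ (RGenOpens.measurableE R)).
move=> _ [_ [a [b ->] <-]].
have /open_subspaceP[V oV VD] := cf _ (@interval_open R (BRight a) (BLeft b) isT isT).
rewrite setIC -VD; apply: measurableI; last exact: measurable_circle.
exact: sub_sigma_algebra.
Qed.

Lemma circle_continuous_bounded f : CT f ->
  exists2 M, 0 < M & forall z, normc z = 1 -> `|f z| <= M.
Proof.
move=> cf.
have /(continuous_compact cf)/compact_bounded := @compact_circle R.
move=> /ex_strict_bound_gt0 => -[M M0 h].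
by exists M => // z z1; apply/ltW/h; exists z.
Qed.

Variable nu : {measure set (borelC R) -> \bar R}.
Hypothesis nuT : nu (T : set (borelC R)) = 1%E.

Lemma circle_continuous_integrable f :
  CT f -> nu.-integrable (T : set (borelC R)) (EFin \o (f : borelC R -> R)).
Proof.
move=> cf; apply: measurable_bounded_integrable.
- exact: measurable_circle.
- by rewrite nuT ltry.
- exact: circle_continuous_measurable.
- have [M M0 h] := circle_continuous_bounded cf.
  exists M; split; first by rewrite num_real.
  by move=> x Mx z Tz; apply: le_trans (ltW Mx); exact: h.
Qed.

Definition mean (f : R[i]^o -> R) : R :=
  \int[nu]_(z in (T : set (borelC R))) (f : borelC R -> R) z.

Lemma meanE f : CT f ->
  (\int[nu]_(z in (T : set (borelC R))) (f z)%:E)%E = (mean f)%:E.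
Proof.
move=> cf; rewrite /mean /Rintegral fineK //.
exact: (integrable_fin_num measurable_circle (circle_continuous_integrable cf)).
Qed.

Lemma eq_mean f g : (forall z, normc z = 1 -> f z = g z) -> mean f = mean g.
Proof. by move=> fg; apply: eq_Rintegral => z /set_mem /fg. Qed.

Lemma mean_cst (c : R) : mean (fun=> c) = c.
Proof.
by rewrite /mean Rintegral_cst ?nuT ?mulr1 //; exact: measurable_circle.
Qed.

Lemma meanD f g : CT f -> CT g -> mean (fun z => f z + g z) = mean f + mean g.
Proof.
move=> cf cg; apply: RintegralD; first exact: measurable_circle.
  exact: circle_continuous_integrable.
exact: circle_continuous_integrable.
Qed.

Lemma meanB f g : CT f -> CT g -> mean (fun z => f z - g z) = mean f - mean g.
Proof.
move=> cf cg; apply: RintegralB; first exact: measurable_circle.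
  exact: circle_continuous_integrable.
exact: circle_continuous_integrable.
Qed.

Lemma meanZ c f : CT f -> mean (fun z => c * f z) = c * mean f.
Proof.
move=> cf; apply: RintegralZl; first exact: measurable_circle.
exact: circle_continuous_integrable.
Qed.

Lemma mean_sum (I : Type) (s : seq I) (F : I -> R[i]^o -> R) :
  (forall i, CT (F i)) ->
  mean (fun z => \sum_(i <- s) F i z) = \sum_(i <- s) mean (F i).
Proof.
move=> cF; elim: s => [|i s IH].
  rewrite big_nil -[RHS]mean_cst; apply: eq_mean => z _.
  by rewrite big_nil.
rewrite big_cons -IH -meanD //; last exact: circle_continuous_sum.
by apply: eq_mean => z _; rewrite big_cons.
Qed.

Lemma le_mean f g : CT f -> CT g -> (forall z, normc z = 1 -> f z <= g z) ->
  mean f <= mean g.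
Proof.
move=> cf cg fg; apply: le_Rintegral => //; first exact: measurable_circle.
  exact: circle_continuous_integrable.
exact: circle_continuous_integrable.
Qed.

Lemma mean_near f g e : CT f -> CT g -> (forall z, normc z = 1 -> `|f z - g z| <= e) ->
  `|mean f - mean g| <= e.
Proof.
move=> cf cg fg; rewrite -meanB //.
have cfg := circle_continuousB cf cg.
have h z (z1 : normc z = 1) : - e <= f z - g z <= e by rewrite -ler_norml fg.
have h1 : mean (fun=> - e) <= mean (fun z => f z - g z).
  apply: le_mean => //; first exact: circle_continuous_cst.
  by move=> z /h /andP[].
have h2 : mean (fun z => f z - g z) <= mean (fun=> e).
  apply: le_mean => //; first exact: circle_continuous_cst.
  by move=> z /h /andP[].
by move: h1 h2; rewrite !mean_cst ler_norml => -> ->.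
Qed.

End circle_mean.

(** * Uniform approximation by trigonometric polynomials *)

Section roots_of_unity.
Variable R : realType.
Implicit Types (z w u : R[i]).

Lemma expiD (s t : R) : expi (s + t) = expi s * expi t.
Proof. by apply: complex_eqP; rewrite ?ReM ?ImM /= ?cosD ?sinD //; ring. Qed.

Lemma expiMn (t : R) n : expi (t *+ n) = expi t ^+ n.
Proof.
elim: n => [|n IH]; first by rewrite mulr0n expr0 /expi cos0 sin0.
by rewrite mulrSr exprSr expiD IH.
Qed.

Lemma unit_primitive_root n : (0 < n)%N ->
  exists2 w : R[i], n.-primitive_root w & normc w = 1.
Proof.
move=> n0; pose t : R := 2 * pi / n%:R.
have nR : n%:R != 0 :> R by rewrite pnatr_eq0 -lt0n.
have tn : expi t ^+ n = 1.
  rewrite -expiMn (_ : t *+ n = pi *+ 2); last first.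
    by rewrite -[LHS]mulr_natr /t divfK // mulr_natl.
  by rewrite /expi cos2pi sin2pi.
exists (expi t); last exact: normc_expi.
have [m mP mn] := prim_order_exists n0 tn.
have m0 := prim_order_gt0 mP.
have [->//|nm] := eqVneq n m.
have ltmn : (m < n)%N by rewrite ltn_neqAle eq_sym nm dvdn_leq.
pose x : R := pi * m%:R / n%:R.
have x0 : 0 < x < pi.
  have n0R : 0 < n%:R :> R by rewrite ltr0n.
  rewrite /x divr_gt0 ?mulr_gt0 ?pi_gt0 ?ltr0n //=.
  by rewrite ltr_pdivrMr // ltr_pM2l ?pi_gt0 // ltr_nat.
have : cos (x + x) = 1.
  have := prim_expr_order mP; rewrite -expiMn => /(congr1 (@complex.Re R)) /= <-.
  by congr cos; rewrite -[RHS]mulr_natr /x /t; field.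
rewrite cosD => c1; have := sin_gt0_pi x0; have := cos2Dsin2 x => e s0.
have : sin x ^+ 2 = 0 by rewrite !expr2 in e *; lra.
by move/eqP; rewrite sqrf_eq0 gt_eqF.
Qed.

Lemma sum_root_powers n w a b : n.-primitive_root w -> normc w = 1 ->
  (a < n)%N -> (b < n)%N ->
  \sum_(j < n) (w ^+ j)^*%C ^+ a * (w ^+ j) ^+ b = n%:R * (a == b)%:R.
Proof.
move=> wP w1 an bn.
pose q := w^*%C ^+ a * w ^+ b.
have qE (j : 'I_n) : (w ^+ j)^*%C ^+ a * (w ^+ j) ^+ b = q ^+ j.
  by rewrite conjcX /q exprMn -!exprM ![(j * _)%N]mulnC.
under eq_bigr do rewrite qE.
have wu := unit_mul_conj w1.
have qw : q * w ^+ a = w ^+ b.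
  by rewrite mulrAC -exprMn [_ * w]mulrC wu expr1n mul1r.
have qn : q ^+ n = 1.
  rewrite /q exprMn -!exprM ![(_ * n)%N]mulnC !exprM -conjcX (prim_expr_order wP).
  by rewrite conjc1 !expr1n mulr1.
case: eqP => [ab|/eqP ab].
  have -> : q = 1 by rewrite /q -ab -exprMn [_ * w]mulrC wu expr1n.
  under eq_bigr do rewrite expr1n.
  by rewrite sumr_const card_ord mulr1.
have q1 : q - 1 != 0.
  rewrite subr_eq0; apply: contra ab => /eqP q1; move: qw; rewrite q1 mul1r.
  by move/eqP; rewrite (eq_prim_root_expr wP) !modn_small.
by apply: (mulfI q1); rewrite -subrX1 qn subrr mulr0 mulr0.
Qed.

End roots_of_unity.

Section fejer.
Variable R : realType.
Notation T := (@unit_circle R).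
Implicit Types (f p q : R[i]^o -> R) (z w u : R[i]).

(** Real trigonometric polynomials, seen as functions on the circle: only the
    values there matter, hence the last constructor. *)
Inductive trig : (R[i]^o -> R) -> Prop :=
| trig_cst c : trig (fun=> c)
| trig_Re m : trig (fun z => Re ((z : R[i]) ^+ m.+1))
| trig_Im m : trig (fun z => Im ((z : R[i]) ^+ m.+1))
| trigD p q : trig p -> trig q -> trig (fun z => p z + q z)
| trigZ c p : trig p -> trig (fun z => c * p z)
| trig_ext p q : (forall z, normc z = 1 -> p z = q z) -> trig p -> trig q.

Lemma trig_sum (I : Type) (s : seq I) (F : I -> R[i]^o -> R) :
  (forall i, trig (F i)) -> trig (fun z => \sum_(i <- s) F i z).
Proof.
move=> tF; elim: s => [|i s IH].
  by apply: trig_ext (trig_cst 0) => z _; rewrite big_nil.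
by apply: trig_ext (trigD (tF i) IH) => z _; rewrite big_cons.
Qed.

(** On the circle one of the two powers cancels, which leaves a power of [z] or
    of its conjugate. *)
Lemma trig_mixed a b c :
  trig (fun z => Re ((z : R[i]) ^+ a * (z : R[i])^*%C ^+ b * c)).
Proof.
have trRe m : trig (fun z => Re ((z : R[i]) ^+ m)).
  by case: m => [|m]; [exact: trig_cst|exact: trig_Re].
have trIm m : trig (fun z => Im ((z : R[i]) ^+ m)).
  by case: m => [|m]; [exact: trig_cst|exact: trig_Im].
have unit_cancel z i j : normc z = 1 -> z ^+ (i + j) * z^*%C ^+ j = z ^+ i.
  by move=> z1; rewrite exprD -mulrA -exprMn unit_mul_conj // expr1n mulr1.
have [ba|/ltnW ab] := leqP b a.
  apply: trig_ext (trigD (trigZ (Re c) (trRe (a - b)%N))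
                         (trigZ (- Im c) (trIm (a - b)%N))) => z z1.
  by rewrite -[in RHS](subnK ba) unit_cancel // ReM; ring.
apply: trig_ext (trigD (trigZ (Re c) (trRe (b - a)%N))
                       (trigZ (Im c) (trIm (b - a)%N))) => z z1.
have -> : (z : R[i]) ^+ a * (z : R[i])^*%C ^+ b = ((z : R[i]) ^+ (b - a))^*%C.
  rewrite -(unit_cancel z (b - a)%N a z1) subnK // conjcM !conjcX conjcK.
  by rewrite mulrC.
by rewrite ReM Re_conj Im_conj; ring.
Qed.

Definition fejer_kernel N u : R := normc (\sum_(a < N) u ^+ a) ^+ 2.

Lemma sqr_normcE z : (normc z ^+ 2)%:C = z * z^*%C.
Proof.
apply: complex_eqP; rewrite ?ReM ?ImM Re_conj Im_conj ?sqr_normc /=; ring.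
Qed.

Lemma conjc_sum (I : Type) (s : seq I) (F : I -> R[i]) :
  (\sum_(i <- s) F i)^*%C = \sum_(i <- s) (F i)^*%C.
Proof. exact: rmorph_sum. Qed.

Lemma fejer_kernelE N z w : (fejer_kernel N (z * w^*%C))%:C =
  \sum_(a < N) \sum_(b < N) z ^+ a * z^*%C ^+ b * (w^*%C ^+ a * w ^+ b).
Proof.
rewrite /fejer_kernel sqr_normcE conjc_sum mulr_suml.
apply: eq_bigr => a _; rewrite mulr_sumr; apply: eq_bigr => b _.
by rewrite conjcX conjcM conjcK !exprMn mulrACA.
Qed.

Lemma trig_fejer_kernel N w : trig (fun z => fejer_kernel N ((z : R[i]) * w^*%C)).
Proof.
apply: (@trig_ext (fun z => \sum_(a < N) \sum_(b < N)
   Re ((z : R[i]) ^+ a * (z : R[i])^*%C ^+ b * (w^*%C ^+ a * w ^+ b)))).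
  move=> z _; have /(congr1 (@complex.Re R)) /= -> := fejer_kernelE N z w.
  rewrite (raddf_sum (@complex.Re R : Rcomplex R -> R)); apply: eq_bigr => a _.
  by rewrite (raddf_sum (@complex.Re R : Rcomplex R -> R)).
apply: trig_sum => a; apply: trig_sum => b; exact: trig_mixed.
Qed.

(** All the frequencies of the kernel are smaller than [N], so that averaging
    over the [N]-th roots of unity only keeps the constant term. *)
Lemma sum_fejer_kernel N z w : N.-primitive_root w -> normc w = 1 -> normc z = 1 ->
  \sum_(j < N) fejer_kernel N (z * (w ^+ j)^*%C) = N%:R ^+ 2.
Proof.
move=> wP w1 z1; apply: (@complexI R); rewrite rmorph_sum /=.
under eq_bigr do rewrite fejer_kernelE.
rewrite exchange_big /=.
transitivity (\sum_(a < N) N%:R : R[i]).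
  apply: eq_bigr => a _; rewrite exchange_big /=.
  rewrite (bigD1 a) //= -mulr_sumr sum_root_powers // eqxx mulr1.
  rewrite -exprMn unit_mul_conj // expr1n mul1r big1 ?addr0 // => b ba.
  rewrite -mulr_sumr sum_root_powers // (_ : (_ == _) = false) ?mulr0 //.
  by apply/negbTE; rewrite eq_sym.
rewrite sumr_const card_ord -[LHS]mulr_natr -expr2.
by rewrite (rmorphXn (real_complex R)) rmorph_nat.
Qed.

(** With [u = z w^*] the left-hand side is [|u^N - 1|^2], because the kernel is
    the square of a geometric sum. *)
Lemma fejer_kernel_moment N z w : normc z = 1 -> normc w = 1 ->
  normc (z - w) ^+ 2 * fejer_kernel N (z * w^*%C) <= 4.
Proof.
move=> z1 w1; have u1 : normc (z * w^*%C) = 1 by rewrite normcM normc_conj z1 w1 mulr1.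
have -> : normc (z - w) = normc (z * w^*%C - 1).
  by rewrite -[LHS]mulr1 -[in LHS]w1 -(normc_conj w) -normcM mulrBl unit_mul_conj.
rewrite -exprMn -normcM -subrX1.
have h : normc ((z * w^*%C) ^+ N - 1) <= 2.
  by apply: normcB_le_unit; rewrite ?normcX ?u1 ?expr1n ?normc1.
rewrite (_ : 4 = 2 ^+ 2); last by ring.
by rewrite lerXn2r // nnegrE ?normc_ge0.
Qed.

Lemma fejer_kernel_ge0 N u : 0 <= fejer_kernel N u.
Proof. by rewrite /fejer_kernel exprn_ge0 // normc_ge0. Qed.

(** Fejer interpolation at the [N]-th roots of unity is a positive operator that
    reproduces constants and whose second moment is at most [4 / N]; Korovkin's
    argument applies. *)
Lemma trig_dense f e : {within T, continuous f} -> 0 < e ->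
  exists2 p, trig p & forall z, normc z = 1 -> `|f z - p z| <= e.
Proof.
move=> cf e0.
have [M M0 fM] := circle_continuous_bounded cf.
have e2 : 0 < e / 2 by rewrite divr_gt0.
have [d d0 fd] := circle_uniformly_continuous cf e2.
pose C := 2 * M / d ^+ 2.
have C0 : 0 < C by rewrite /C divr_gt0 ?mulr_gt0 ?exprn_gt0.
have modulus z w : normc z = 1 -> normc w = 1 ->
    `|f z - f w| <= e / 2 + C * normc (z - w) ^+ 2.
  move=> z1 w1; have [zw|zw] := ltP (normc (z - w)) d.
    apply: le_trans (ltW (fd _ _ z1 w1 zw)) _.
    by rewrite lerDl; apply: mulr_ge0; [exact: ltW|exact/exprn_ge0/normc_ge0].
  apply: (@le_trans _ _ (2 * M)).
    apply: le_trans (ler_normB _ _) _.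
    by have := fM z z1; have := fM w w1; lra.
  apply: (@le_trans _ _ (C * normc (z - w) ^+ 2)); last by rewrite lerDr ltW.
  have -> : 2 * M = C * d ^+ 2 by rewrite /C divfK // expf_neq0 // gt_eqF.
  by rewrite ler_pM2l //; apply: lerXn2r => //; rewrite ?nnegrE ?normc_ge0 //; exact: ltW.
(* the total error is at most [e / 2 + 4 C / N] *)
pose N := (Num.truncn (8 * C / e)).+1.
have NR : 8 * C / e < N%:R by apply: truncnS_gt.
have N0 : 0 < N%:R :> R by rewrite ltr0n.
have [w wP w1] := @unit_primitive_root R N isT.
have wj j : normc (w ^+ j) = 1 by rewrite normcX w1 expr1n.
exists (fun z => N%:R ^- 2 *
   \sum_(j < N) f (w ^+ j) * fejer_kernel N ((z : R[i]) * (w ^+ j)^*%C)).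
  apply: trigZ; apply: trig_sum => j; apply: trigZ; exact: trig_fejer_kernel.
move=> z z1; have sumK := sum_fejer_kernel wP w1 z1.
have N2 : 0 < N%:R ^+ 2 :> R by rewrite exprn_gt0.
have -> : f z = N%:R ^- 2 * \sum_(j < N) f z * fejer_kernel N (z * (w ^+ j)^*%C).
  by rewrite -mulr_sumr sumK mulrC mulfK // gt_eqF.
rewrite -mulrBr -sumrB normrM ger0_norm ?invr_ge0 ?(ltW N2) //.
rewrite mulrC ler_pdivrMr //.
apply: le_trans (ler_norm_sum _ _ _) _.
apply: (@le_trans _ _ (\sum_(j < N)
   (e / 2 * fejer_kernel N (z * (w ^+ j)^*%C) + 4 * C))).
  apply: ler_sum => j _; rewrite -mulrBl normrM (ger0_norm (fejer_kernel_ge0 _ _)).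
  apply: (@le_trans _ _ ((e / 2 + C * normc (z - w ^+ j) ^+ 2) *
     fejer_kernel N (z * (w ^+ j)^*%C))).
    by rewrite ler_wpM2r ?fejer_kernel_ge0 ?modulus.
  rewrite mulrDl lerD2l -mulrA [4 * C]mulrC ler_pM2l //.
  exact: fejer_kernel_moment.
rewrite big_split /= -mulr_sumr sumK sumr_const card_ord -[X in _ + X]mulr_natr.
move: NR; rewrite ltr_pdivrMr // => NR.
rewrite expr2; nra.
Qed.

End fejer.

(** * Convergence of measures and moments *)

Section weyl.
Variables (R : realType) (phi : R[i]^o -> R[i]^o).
Notation T := (@unit_circle R).
Notation CT f := {within T, continuous f}.
Hypothesis cphi : CT phi.
Hypothesis phi1 : forall z, normc z = 1 -> normc (phi z) = 1.
Implicit Types (f p q : R[i]^o -> R) (nu : {measure set (borelC R) -> \bar R}).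

Lemma circle_continuous_precomp f : CT f -> CT (fun z => f (phi z)).
Proof.
move=> /subspace_continuousP cf; apply/subspace_continuousP => z z1.
apply: cvg_comp (cf _ (phi1 z1)) => U /= hU.
have /subspace_continuousP/(_ z z1) hphi := cphi.
have : within T (nbhs z) (fun y => T (phi y) -> U (phi y)) := hphi _ hU.
rewrite /fmap /within /=; apply: (@filterS _ (nbhs z)) => y h y1.
exact: h y1 (phi1 y1).
Qed.

Lemma circle_continuous_moment m :
  CT (fun z => Re ((phi z : R[i]) ^+ m)) /\ CT (fun z => Im ((phi z : R[i]) ^+ m)).
Proof.
split.
  exact: (@circle_continuous_comp _ R[i]^o _ (@complex.Re R)
    (@circle_continuousX _ phi m cphi) (@continuous_Re R)).
exact: (@circle_continuous_comp _ R[i]^o _ (@complex.Im R)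
    (@circle_continuousX _ phi m cphi) (@continuous_Im R)).
Qed.

Lemma circle_continuous_trig p : trig p -> CT (fun z => p (phi z)).
Proof.
elim=> {p} [c|m|m|p q _ cp _ cq|c p _ cp|p q pq _ cp].
- exact: circle_continuous_cst.
- by have [] := circle_continuous_moment m.+1.
- by have [] := circle_continuous_moment m.+1.
- exact: circle_continuousD.
- by apply: circle_continuousM => //; exact: circle_continuous_cst.
- apply: subspace_eq_continuous cp => z /set_mem /phi1 z1; exact: pq.
Qed.

Definition cos_moment nu m : R := mean nu (fun z => Re ((phi z : R[i]) ^+ m)).
Definition sin_moment nu m : R := mean nu (fun z => Im ((phi z : R[i]) ^+ m)).

Hypothesis phiK : forall z, normc z = 1 -> phi (phi z) = z.

(** Weyl's criterion: on trigonometric polynomials in [phi] convergence is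
    exactly convergence of the moments, and these functions are uniformly
    dense because [phi] is a homeomorphism of the circle. *)
Lemma weyl_criterion (nu_ : nat -> {measure set (borelC R) -> \bar R}) nu f :
  (forall n, nu_ n (T : set (borelC R)) = 1%E) -> nu (T : set (borelC R)) = 1%E ->
  (forall m, cos_moment (nu_ n) m.+1 @[n --> \oo] --> cos_moment nu m.+1) ->
  (forall m, sin_moment (nu_ n) m.+1 @[n --> \oo] --> sin_moment nu m.+1) ->
  CT f -> mean (nu_ n) f @[n --> \oo] --> mean nu f.
Proof.
move=> nu_T nuT hcos hsin cf.
have htrig p : trig p -> mean (nu_ n) (fun z => p (phi z)) @[n --> \oo] -->
    mean nu (fun z => p (phi z)).
  elim=> {p} [c|m|m|p q tp IHp tq IHq|c p tp IHp|p q pq _ IHp].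
  - under eq_fun do rewrite mean_cst //.
    rewrite mean_cst //; exact: cvg_cst.
  - exact: hcos.
  - exact: hsin.
  - have cp := circle_continuous_trig tp; have cq := circle_continuous_trig tq.
    under eq_fun do rewrite meanD //.
    rewrite meanD //; exact: cvgD.
  - have cp := circle_continuous_trig tp.
    under eq_fun do rewrite meanZ //.
    rewrite meanZ //; apply: cvgM => //; exact: cvg_cst.
  - have e nu' : mean nu' (fun z => q (phi z)) = mean nu' (fun z => p (phi z)).
      by apply: eq_mean => z /phi1 z1; rewrite pq.
    under eq_fun do rewrite e.
    by rewrite e.
apply/cvgrPdist_lt => e e0.
have e3 : 0 < e / 3 by rewrite divr_gt0.
have [p tp fp] := trig_dense (circle_continuous_precomp cf) e3.
have cp := circle_continuous_trig tp.
have near_p z : normc z = 1 -> `|f z - p (phi z)| <= e / 3.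
  by move=> z1; rewrite -{1}(phiK z1); apply: fp; exact: phi1.
have /cvgrPdist_lt/(_ _ e3) := htrig _ tp.
apply: filterS => n hn.
have h1 := mean_near nuT cf cp near_p.
have h2 := mean_near (nu_T n) cf cp near_p.
move: hn h1 h2; rewrite !ltr_norml !ler_norml => /andP[a b] /andP[c d] /andP[g h].
by apply/andP; split; lra.
Qed.

End weyl.

(** * The weighted energy *)

(** The positive and negative parts of an integral are suprema over simple
    functions, hence monotone for arbitrary functions. This form serves iterated
    integrals, whose inner integral has no obvious measurability. *)
Lemma le_integral_pointwise (R : realType) (d : measure_display)
    (X : measurableType d) (mu : {measure set X -> \bar R}) (D : set X)
    (f g : X -> \bar R) :
  (forall x, D x -> (f x <= g x)%E) ->
  (\int[mu]_(x in D) f x <= \int[mu]_(x in D) g x)%E.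
Proof.
move=> fg; have h x : ((f \_ D) x <= (g \_ D) x)%E.
  by rewrite /patch; case: ifPn => [/set_mem /fg|].
rewrite /integral; apply: leeB; apply: ereal_sup_le => _ [k /= hk <-];
  exists k => //= x; apply: le_trans (hk x) _.
  by apply: (@funepos_le _ _ setT) => //; rewrite inE.
by apply: (@funeneg_le _ _ setT) => //; rewrite inE.
Qed.

Lemma le_of_geometric_error (R : realType) (x y c r : R) : 0 <= r -> r < 1 ->
  (forall K, x <= y + c * r ^+ K) -> x <= y.
Proof.
move=> r0 r1 h.
have hl : (fun K => y + c * r ^+ K) @ \oo --> y + c * 0.
  apply: cvgD; first exact: cvg_cst.
  apply: cvgM; first exact: cvg_cst.
  by apply: cvg_expr; rewrite ger0_norm.
rewrite mulr0 addr0 in hl.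
by apply: (cvgr_to_ge hl); exact: nearW.
Qed.

(** The factor [exp (- d)^(m + 1)] is at least [exp (- (m + 1))] when [d <= 1]. *)
Lemma le_of_discounted (R : realType) m (d q x : R) : d <= 1 -> 0 <= q ->
  expR (- d) ^+ m.+1 / m.+1%:R * q <= x -> q <= m.+1%:R * expR m.+1%:R * x.
Proof.
move=> d1 q0 hq.
pose M : R := m.+1%:R * expR m.+1%:R.
have M0 : 0 < M by rewrite mulr_gt0 ?ltr0n ?expR_gt0.
have pw : 1 <= expR m.+1%:R * expR (- d) ^+ m.+1.
  rewrite -expRM_natl -expRD; apply: le_trans (expR_ge1Dx _); rewrite lerDl.
  have : 0 <= m.+1%:R * (1 - d) by rewrite mulr_ge0 // subr_ge0.
  by rewrite mulrBr mulr1 mulrN.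
apply: (@le_trans _ _ (M * (expR (- d) ^+ m.+1 / m.+1%:R * q))); last first.
  by rewrite ler_pM2l.
have -> : M * (expR (- d) ^+ m.+1 / m.+1%:R * q) =
    expR m.+1%:R * expR (- d) ^+ m.+1 * q by rewrite /M; field.
by rewrite ler_peMl.
Qed.

Section energy.
Variables (R : realType) (phi : R[i]^o -> R[i]^o) (w : R[i] -> R) (A : R).
Notation T := (@unit_circle R).
Notation CT f := {within T, continuous f}.
Hypothesis cphi : CT phi.
Hypothesis phi1 : forall z, normc z = 1 -> normc (phi z) = 1.
Hypothesis phiK : forall z, normc z = 1 -> phi (phi z) = z.
Hypothesis A0 : 0 < A.
Hypothesis phi_dist : forall z t, normc z = 1 -> normc t = 1 ->
  normc (phi z - phi t) = A * (normc (z - t) * w z * w t).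
Implicit Types (f p q : R[i]^o -> R).

Lemma phi_neq z t : normc z = 1 -> normc t = 1 -> z != t -> phi z != phi t.
Proof.
move=> z1 t1; apply: contra => /eqP e.
by rewrite -(phiK z1) -(phiK t1) e.
Qed.

Lemma weighted_kernel_diag z : weighted_kernel w z z = +oo%E.
Proof.
by rewrite /weighted_kernel subrr normc0 !mul0r inve0.
Qed.

Lemma weighted_kernelE z t : normc z = 1 -> normc t = 1 -> z != t ->
  weighted_kernel w z t = (ln A - ln (normc (phi z - phi t)))%:E.
Proof.
move=> z1 t1 zt.
have d0 : 0 < normc (phi z - phi t).
  by rewrite normc_gt0 subr_eq0 phi_neq.
have k0 : 0 < normc (z - t) * w z * w t by rewrite phi_dist // pmulr_rgt0 in d0.
rewrite phi_dist // lnM ?posrE // /weighted_kernel inver gt_eqF //=.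
by rewrite leNgt invr_gt0 k0 /= lnV ?posrE //; congr EFin; ring.
Qed.

Section lower.
Variable nu : probability (borelC R) R.
Hypothesis nuT : nu (T : set (borelC R)) = 1%E.

(** Integrating the positive definite lower bound of the kernel twice produces
    the squares of the moments. *)
Lemma weighted_energy_lower_sum r K : 0 < r -> r < 1 ->
  ((ln A + 2^-1 * ln r + \sum_(k < K) r ^+ k.+1 / k.+1%:R *
      (cos_moment phi nu k.+1 ^+ 2 + sin_moment phi nu k.+1 ^+ 2)
     - r ^+ K.+1 / (1 - r))%:E <= weighted_energy w nu)%E.
Proof.
move=> r0 r1.
pose c0 := ln A + 2^-1 * ln r - r ^+ K.+1 / (1 - r).
pose q k : R := r ^+ k.+1 / k.+1%:R.
have crs k := circle_continuous_moment cphi k.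
pose G z t : R := c0 + \sum_(k < K) q k *
  (Re ((phi z : R[i]) ^+ k.+1) * Re ((phi t : R[i]) ^+ k.+1) +
   Im ((phi z : R[i]) ^+ k.+1) * Im ((phi t : R[i]) ^+ k.+1)).
have GE z t : normc z = 1 -> normc t = 1 -> ((G z t)%:E <= weighted_kernel w z t)%E.
  move=> z1 t1; have [<-|zt] := eqVneq z t; first by rewrite weighted_kernel_diag leey.
  rewrite weighted_kernelE // lee_fin.
  have := ln_dist_lower K (phi1 z1) (phi1 t1) (phi_neq z1 t1 zt) r0 r1.
  have -> : \sum_(k < K) r ^+ k.+1 / k.+1%:R * Re ((phi z * (phi t)^*%C) ^+ k.+1) =
      \sum_(k < K) q k *
  (Re ((phi z : R[i]) ^+ k.+1) * Re ((phi t : R[i]) ^+ k.+1) +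
   Im ((phi z : R[i]) ^+ k.+1) * Im ((phi t : R[i]) ^+ k.+1)).
    apply: eq_bigr => k _; congr (_ * _).
    by rewrite exprMn -conjcX ReM Re_conj Im_conj; ring.
  by rewrite /G /c0; lra.
pose H z : R := c0 + \sum_(k < K) q k *
  (Re ((phi z : R[i]) ^+ k.+1) * cos_moment phi nu k.+1 +
   Im ((phi z : R[i]) ^+ k.+1) * sin_moment phi nu k.+1).
have cst c : CT (fun=> c : R) := @circle_continuous_cst R c.
have cM (c : R) f : CT f -> CT (fun z => c * f z) by move=> cf; exact: circle_continuousM.
have cMr (c : R) f : CT f -> CT (fun z => f z * c).
  by move=> cf; exact: circle_continuousM.
have cterm z (k : 'I_K) : CT (fun t => q k *
  (Re ((phi z : R[i]) ^+ k.+1) * Re ((phi t : R[i]) ^+ k.+1) +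
   Im ((phi z : R[i]) ^+ k.+1) * Im ((phi t : R[i]) ^+ k.+1))).
  have [cr cs] := crs k.+1.
  by apply: (cM _); apply: circle_continuousD; apply: (cM _).
have cG z : CT (G z).
  by apply: circle_continuousD => //; exact: circle_continuous_sum.
have cterm' (k : 'I_K) : CT (fun z => q k *
  (Re ((phi z : R[i]) ^+ k.+1) * cos_moment phi nu k.+1 +
   Im ((phi z : R[i]) ^+ k.+1) * sin_moment phi nu k.+1)).
  have [cr cs] := crs k.+1.
  by apply: (cM _); apply: circle_continuousD; apply: (cMr _).
have cH : CT H.
  by apply: circle_continuousD => //; exact: circle_continuous_sum.
have GH z : mean nu (G z) = H z.
  rewrite /G (meanD nuT) //; last exact: circle_continuous_sum.
  rewrite (mean_cst nuT) // (mean_sum nuT) //; congr (_ + _); apply: eq_bigr => k _.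
  have [cr cs] := crs k.+1.
  rewrite (meanZ nuT); last by apply: circle_continuousD; apply: (cM _).
  by rewrite (meanD nuT) ?(meanZ nuT) //; apply: (cM _).
have HE : mean nu H = ln A + 2^-1 * ln r + \sum_(k < K) r ^+ k.+1 / k.+1%:R *
      (cos_moment phi nu k.+1 ^+ 2 + sin_moment phi nu k.+1 ^+ 2)
     - r ^+ K.+1 / (1 - r).
  rewrite /H (meanD nuT) //; last exact: circle_continuous_sum.
  rewrite (mean_cst nuT) // (mean_sum nuT) //.
  have -> : \sum_(k < K) mean nu (fun z => q k *
      (Re ((phi z : R[i]) ^+ k.+1) * cos_moment phi nu k.+1 +
       Im ((phi z : R[i]) ^+ k.+1) * sin_moment phi nu k.+1)) =
      \sum_(k < K) r ^+ k.+1 / k.+1%:R *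
      (cos_moment phi nu k.+1 ^+ 2 + sin_moment phi nu k.+1 ^+ 2).
    apply: eq_bigr => k _; have [cr cs] := crs k.+1.
    rewrite (meanZ nuT); last by apply: circle_continuousD; apply: (cMr _).
    rewrite (meanD nuT); [|exact: (cMr _)|exact: (cMr _)].
    have comm c f : CT f -> mean nu (fun z => f z * c) = c * mean nu f.
      by move=> cf; rewrite -(meanZ nuT) //; apply: eq_mean => z _; rewrite mulrC.
    by rewrite !comm // -!expr2.
  by rewrite /c0 /q; ring.
rewrite -HE -(meanE nuT) //; apply: le_integral_pointwise => z z1.
rewrite -GH -(meanE nuT) //; apply: le_integral_pointwise => t t1.
exact: GE.
Qed.

Lemma weighted_energy_lower m r : 0 < r -> r < 1 ->
  ((ln A + 2^-1 * ln r + r ^+ m.+1 / m.+1%:R *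
      (cos_moment phi nu m.+1 ^+ 2 + sin_moment phi nu m.+1 ^+ 2))%:E
   <= weighted_energy w nu)%E.
Proof.
move=> r0 r1.
have h K := weighted_energy_lower_sum (m.+1 + K)%N r0 r1.
case: (weighted_energy w nu) h => [x| |] h; last 2 first.
- by rewrite leey.
- by have := h 0%N; rewrite leNgt ltNyr.
rewrite lee_fin; apply: (@le_of_geometric_error _ _ _ (r ^+ m.+2 / (1 - r)) r) => [| |K].
- exact: ltW.
- exact: r1.
have := h K; rewrite lee_fin.
rewrite (bigD1 (Ordinal (leq_addr K m.+1))) //=.
set s := \sum_(_ < _ | _) _.
have s0 : 0 <= s.
  apply: sumr_ge0 => k _; rewrite mulr_ge0 ?addr_ge0 ?sqr_ge0 //.
  by rewrite divr_ge0 // exprn_ge0 // ltW.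
have -> : r ^+ (m.+1 + K).+1 / (1 - r) = r ^+ m.+2 / (1 - r) * r ^+ K.
  by rewrite -addSn exprD mulrAC.
move: (_ / (1 - r) * r ^+ K) => tail; move: (r ^+ m.+1 / _ * _) => term.
by move=> hK; lra.
Qed.

Lemma weighted_energy_ge : ((ln A)%:E <= weighted_energy w nu)%E.
Proof.
have h r (r0 : 0 < r) (r1 : r < 1) := weighted_energy_lower 0 r0 r1.
case: (weighted_energy w nu) h => [x| |] h; last 2 first.
- by rewrite leey.
- by have := h 2^-1 ltac:(lra) ltac:(lra); rewrite leNgt ltNyr.
rewrite lee_fin; apply/ler_addgt0Pr => e e0.
pose r := expR (- e).
have r0 : 0 < r := expR_gt0 _.
have r1 : r < 1 by rewrite /r expR_lt1 oppr_lt0.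
have := h r r0 r1; rewrite lee_fin.
have -> : ln r = - e by rewrite expRK.
have : 0 <= r ^+ 1 / 1%:R * (cos_moment phi nu 1 ^+ 2 + sin_moment phi nu 1 ^+ 2).
  by rewrite mulr_ge0 ?addr_ge0 ?sqr_ge0 // divr_ge0 // exprn_ge0 // ltW.
by move: (_ / 1%:R * _) => term; lra.
Qed.

(** As [r] tends to 1 the term of index [m] in the lower bound is squeezed
    between 0 and [- ln r / 2]. *)
Lemma minimizer_moments0 m : (weighted_energy w nu <= (ln A)%:E)%E ->
  cos_moment phi nu m.+1 = 0 /\ sin_moment phi nu m.+1 = 0.
Proof.
move=> E_le.
have h r (r0 : 0 < r) (r1 : r < 1) := le_trans (weighted_energy_lower m r0 r1) E_le.
suff : cos_moment phi nu m.+1 ^+ 2 + sin_moment phi nu m.+1 ^+ 2 <= 0.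
  set c := cos_moment _ _ _; set s := sin_moment _ _ _ => cs0.
  have c2 := sqr_ge0 c; have s2 := sqr_ge0 s.
  have /eqP : c ^+ 2 = 0 by lra.
  have /eqP : s ^+ 2 = 0 by lra.
  by rewrite !sqrf_eq0 => /eqP -> /eqP ->.
set q := _ + _ in h *.
have q0 : 0 <= q by rewrite addr_ge0 ?sqr_ge0.
apply/ler_addgt0Pr => e e0; rewrite add0r.
(* the radius is [r = exp (- d)] *)
pose M : R := m.+1%:R * expR m.+1%:R.
have M0 : 0 < M by rewrite mulr_gt0 ?ltr0n ?expR_gt0.
pose d := Num.min 1 (e / M).
have d0 : 0 < d by rewrite lt_min ltr01 divr_gt0.
have d1 : d <= 1 by rewrite ge_min lexx.
have dM : M * d <= e by rewrite mulrC -ler_pdivlMr // ge_min lexx orbT.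
have r0 : 0 < expR (- d) := expR_gt0 _.
have r1 : expR (- d) < 1 by rewrite expR_lt1 oppr_lt0.
apply: le_trans dM; apply: le_of_discounted d1 q0 _.
have := h _ r0 r1; rewrite lee_fin expRK.
by move: (_ / _ * q) => term; lra.
Qed.

End lower.
Section upper.
Variable nu : probability (borelC R) R.
Hypothesis nuT : nu (T : set (borelC R)) = 1%E.
Hypothesis cos0 : forall m, cos_moment phi nu m.+1 = 0.
Hypothesis sin0 : forall m, sin_moment phi nu m.+1 = 0.

Section potential.
Variable v : R[i].
Hypothesis v1 : normc v = 1.

Definition inner_potential r (t : R[i]^o) : R :=
  - ln (normc (1 - r%:C * (v * (phi t)^*%C))).

Lemma circle_continuous_inner_potential r : 0 <= r -> r < 1 -> CT (inner_potential r).
Proof.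
move=> r0 r1.
have [cr cs] := circle_continuous_moment cphi 1.
pose D (t : R[i]^o) : R := 1 - 2 * r * (Re v * Re ((phi t : R[i]) ^+ 1) +
  Im v * Im ((phi t : R[i]) ^+ 1)) + r ^+ 2.
have vt1 t : normc t = 1 -> normc (v * (phi t)^*%C) = 1.
  by move=> t1; rewrite normcM normc_conj v1 phi1 // mulr1.
have DE t : normc t = 1 -> D t = normc (1 - r%:C * (v * (phi t)^*%C)) ^+ 2.
  move=> t1; rewrite sqr_normc_one_sub ?vt1 // /D.
  by rewrite ReM Re_conj Im_conj !expr1; ring.
have n0 t : normc t = 1 -> 0 < normc (1 - r%:C * (v * (phi t)^*%C)).
  by move=> t1; rewrite (lt_le_trans _ (normc_one_sub_ge (vt1 t t1) r0)) // subr_gt0.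
have cst (c : R) := @circle_continuous_cst R c.
have cD : CT D.
  apply: circle_continuousD => //; apply: circle_continuousB => //.
  apply: circle_continuousM => //; apply: circle_continuousD.
    exact: circle_continuousM.
  exact: circle_continuousM.
apply: (@subspace_eq_continuous _ T _ (fun t => - 2^-1 * ln (D t))).
  move=> t /set_mem t1; rewrite /from_subspace /inner_potential DE // lnXn ?n0 //.
  by rewrite mulr2n; field.
apply/subspace_continuousP => t t1; apply: cvgM; first exact: cvg_cst.
have Dt : 0 < D t by rewrite DE // exprn_gt0 // n0.
have /subspace_continuousP/(_ t t1) := cD.
move=> /cvg_comp; apply; exact: continuous_ln.
Qed.

(** For a fixed radius the Fourier series of the logarithm converges uniformly,
    and each of its terms integrates to a vanishing moment. *)
Lemma mean_inner_potential r : 0 <= r -> r < 1 -> mean nu (inner_potential r) = 0.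
Proof.
move=> r0 r1; apply/eqP; rewrite -normr_le0.
apply: (@le_of_geometric_error _ _ _ (r / (1 - r)) r) => // K; rewrite add0r.
have crs k := circle_continuous_moment cphi k.
have cst c : CT (fun=> c : R) := @circle_continuous_cst R c.
have cM (c : R) f : CT f -> CT (fun z => c * f z) by move=> cf; exact: circle_continuousM.
pose q k : R := r ^+ k.+1 / k.+1%:R.
have cterm (k : 'I_K) : CT (fun t => q k *
  (Re (v ^+ k.+1) * Re ((phi t : R[i]) ^+ k.+1) +
   Im (v ^+ k.+1) * Im ((phi t : R[i]) ^+ k.+1))).
  have [cr cs] := crs k.+1.
  by apply: (cM _); apply: circle_continuousD; apply: (cM _).
have -> : r / (1 - r) * r ^+ K = r ^+ K.+1 / (1 - r) by rewrite exprS; ring.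
have S0 : mean nu (fun t => \sum_(k < K) q k *
  (Re (v ^+ k.+1) * Re ((phi t : R[i]) ^+ k.+1) +
   Im (v ^+ k.+1) * Im ((phi t : R[i]) ^+ k.+1))) = 0.
  rewrite (mean_sum nuT) // big1 // => k _.
  have [cr cs] := crs k.+1.
  rewrite (meanZ nuT); last by apply: circle_continuousD; apply: (cM _).
  rewrite (meanD nuT) ?(meanZ nuT) //; try exact: (cM _).
  have := cos0 k; have := sin0 k; rewrite /cos_moment /sin_moment => -> ->.
  by rewrite !mulr0 addr0 mulr0.
rewrite -[mean _ _]subr0 -S0; apply: (mean_near nuT).
- exact: circle_continuous_inner_potential.
- exact: circle_continuous_sum.
move=> t t1; have vt1 : normc (v * (phi t)^*%C) = 1.
  by rewrite normcM normc_conj v1 phi1 // mulr1.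
have := log_series_remainder K vt1 r0 r1.
congr (`|_ - _| <= _); apply: eq_bigr => k _; congr (_ * _).
by rewrite exprMn -conjcX ReM Re_conj Im_conj; ring.
Qed.

End potential.
(** Inside the disc the potential of the image measure is 0; Fatou's lemma
    carries this to the boundary as an inequality, which is all that an upper
    bound of the energy requires. *)
Lemma potential_le z : normc z = 1 ->
  (\int[nu]_(t in (T : set (borelC R))) weighted_kernel w z t <= (ln A)%:E)%E.
Proof.
move=> z1; have v1 := phi1 z1; set v := phi z in v1.
pose r n : R := 1 - n.+2%:R^-1.
have r0 n : 0 <= r n by rewrite subr_ge0 invf_le1 ?ler1n ?ltr0n.
have r1 n : r n < 1 by rewrite ltrBlDr ltrDl invr_gt0 ltr0n.
pose g n (t : R[i]^o) : R := ln 2 + inner_potential v (r n) t.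
have cg n : CT (g n).
  apply: circle_continuousD; first exact: circle_continuous_cst.
  exact: circle_continuous_inner_potential.
pose h n (t : borelC R) : \bar R := (g n t)%:E.
pose F (t : borelC R) : \bar R := (weighted_kernel w z t + (ln 2 - ln A)%:E)%E.
have u1 t : normc t = 1 -> normc (v * (phi t)^*%C) = 1.
  by move=> t1; rewrite normcM normc_conj v1 phi1 // mulr1.
have d0 n t : normc t = 1 -> 0 < normc (1 - (r n)%:C * (v * (phi t)^*%C)).
  move=> t1; rewrite (lt_le_trans _ (normc_one_sub_ge (u1 t t1) (r0 n))) //.
  by rewrite subr_gt0.
have h0 n t : T t -> (0 <= h n t)%E.
  move=> t1; rewrite lee_fin /g /inner_potential subr_ge0 ler_ln ?posrE ?d0 //.
  apply: le_trans (le_normcD _ _) _.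
  rewrite normc1 normcN normcM u1 // mulr1 normc_real ger0_norm //.
  by have := r1 n; lra.
have mh n : @measurable_fun _ _ (borelC R) (\bar R) T (h n).
  by apply/measurable_EFinP; exact: circle_continuous_measurable.
have hF t : T t -> h n t @[n --> \oo] --> F t.
  move=> t1; have [zt|zt] := eqVneq z t.
    (* on the diagonal the approximations are [ln 2 + ln (n + 2)] *)
    rewrite /F -zt weighted_kernel_diag addye //.
    apply/cvgeyPge => M; exists (Num.truncn (expR M)).+1 => // n /= Mn.
    rewrite lee_fin /g /inner_potential -/v unit_mul_conj // mulr1.
    rewrite -(rmorph1 (real_complex R)) -(rmorphB (real_complex R)) normc_real.
    have -> : 1 - r n = n.+2%:R^-1 by rewrite /r; ring.
    rewrite gtr0_norm ?invr_gt0 ?ltr0n // lnV ?posrE ?ltr0n // opprK.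
    have : M <= ln n.+2%:R.
      rewrite -ler_expR lnK ?posrE ?ltr0n //.
      apply: le_trans (ltW (truncnS_gt _)) _; rewrite ler_nat.
      by rewrite (leq_trans Mn) // (leq_trans (leqnSn _)).
    by have : 0 <= ln 2 :> R by [rewrite ln_ge0 // ler1n]; lra.
  have vt0 : 0 < normc (v - phi t) by rewrite normc_gt0 subr_eq0 phi_neq.
  rewrite /F weighted_kernelE // -EFinD.
  have -> : ln A - ln (normc (phi z - phi t)) + (ln 2 - ln A) =
      ln 2 + - 2^-1 * ln (normc (v - phi t) ^+ 2).
    by rewrite lnXn // -/v mulr2n; field.
  apply: cvg_EFin; first exact: nearW.
  have -> : fine \o (h ^~ t) = fun n =>
      ln 2 + - 2^-1 * ln ((1 - r n) ^+ 2 + r n * normc (v - phi t) ^+ 2).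
    apply/funext => n; rewrite /= /g /inner_potential.
    by rewrite -(normc_one_sub_conj (r n) v1 (phi1 t1)) lnXn ?d0 // mulr2n; field.
  apply: cvgD; first exact: cvg_cst.
  apply: cvgM; first exact: cvg_cst.
  have cr : r n @[n --> \oo] --> (1 : R).
    rewrite -[X in _ --> X]subr0; apply: cvgB; first exact: cvg_cst.
    by have := @cvg_harmonic R; rewrite -cvg_shiftS.
  have : (1 - r n) ^+ 2 + r n * normc (v - phi t) ^+ 2 @[n --> \oo] -->
      (1 - 1) ^+ 2 + 1 * normc (v - phi t) ^+ 2.
    apply: cvgD.
      have c1 : 1 - r n @[n --> \oo] --> (1 - 1 : R) by apply: cvgB => //; exact: cvg_cst.
      by rewrite !expr2; apply: cvgM.
    by apply: cvgM => //; exact: cvg_cst.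
  rewrite subrr expr0n add0r mul1r => /cvg_comp; apply.
  by apply: continuous_ln; rewrite exprn_gt0.
have hmean n : (\int[nu]_(t in (T : set (borelC R))) h n t = (ln 2)%:E)%E.
  rewrite (meanE nuT (cg n)) /g (meanD nuT) ?(mean_cst nuT) //.
  - by rewrite mean_inner_potential // addr0.
  - exact: circle_continuous_cst.
  - exact: circle_continuous_inner_potential.
have mT := @measurable_circle R.
have mF : @measurable_fun _ _ (borelC R) (\bar R) T F.
  exact: (emeasurable_fun_cvg h F mh hF).
have F0 t : T t -> (0 <= F t)%E.
  move=> t1; apply: (cvge_to_ge (hF t t1)); apply: nearW => n; exact: h0.
have intF : (\int[nu]_(t in (T : set (borelC R))) F t <= (ln 2)%:E)%E.
  have := fatou nu mT mh h0.
  have -> : limn_einf (fun n => \int[nu]_(t in (T : set (borelC R))) h n t)%E = (ln 2)%:E.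
    under eq_fun do rewrite hmean.
    have c2 : (fun _ : nat => (ln 2 : R)%:E) @ \oo --> (ln 2 : R)%:E by exact: cvg_cst.
    by rewrite (cvg_limn_einf_sup c2).1.
  by under eq_integral => t /set_mem Tt do rewrite (cvg_limn_einf_sup (hF t Tt)).1.
have iF : nu.-integrable (T : set (borelC R)) F.
  apply/integrableP; split=> //.
  under eq_integral => t /set_mem Tt do rewrite gee0_abs ?F0 //.
  by apply: le_lt_trans intF _; rewrite ltry.
have ic : nu.-integrable (T : set (borelC R)) (fun=> (ln A - ln 2)%:E).
  apply: (circle_continuous_integrable nuT (f := fun=> ln A - ln 2)).
  exact: circle_continuous_cst.
under eq_integral => t /set_mem Tt.
  have -> : weighted_kernel w z t = (F t + (ln A - ln 2)%:E)%E.
    rewrite /F -addeA -EFinD.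
    have -> : ln 2 - ln A + (ln A - ln 2) = 0 by ring.
    by rewrite adde0.
  over.
rewrite integralD // (meanE nuT (@circle_continuous_cst R (ln A - ln 2))) (mean_cst nuT).
apply: le_trans (leeD2r _ intF) _; rewrite -EFinD lee_fin.
by rewrite addrC subrK.
Qed.

Lemma weighted_energy_le : (weighted_energy w nu <= (ln A)%:E)%E.
Proof.
apply: (@le_trans _ _ (\int[nu]_(z in (T : set (borelC R))) (ln A)%:E)%E).
  by apply: le_integral_pointwise => z z1; exact: potential_le.
by rewrite (meanE nuT (@circle_continuous_cst R (ln A))) (mean_cst nuT).
Qed.

End upper.
End energy.

(** * Measures on the circle are determined by continuous functions *)

Section measure_determination.
Variable R : realType.
Notation T := (@unit_circle R).

(** Truncated distance to the complement of [U]; the truncation makes it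
    meaningful when the complement is empty. *)
Definition depth (U : set R[i]^o) (z : R[i]^o) : R :=
  sup [set r | 0 <= r <= 1 /\ forall w, normc (z - w) < r -> U w].

Lemma depth_sup (U : set R[i]^o) z :
  has_sup [set r | 0 <= r <= 1 /\ forall w, normc (z - w) < r -> U w].
Proof.
split; last by exists 1 => r [/andP[]].
exists 0; split; first by rewrite lexx ler01.
by move=> w; rewrite ltNge normc_ge0.
Qed.

Lemma depth_ge0 (U : set R[i]^o) z : 0 <= depth U z.
Proof.
apply: ub_le_sup; first by have [] := depth_sup U z.
by split=> [|w]; [rewrite lexx ler01|rewrite ltNge normc_ge0].
Qed.

Lemma depth_le1 (U : set R[i]^o) z : depth U z <= 1.
Proof.
by apply: ge_sup; [have [] := depth_sup U z|move=> r [/andP[]]].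
Qed.

Lemma depth_gt0 (U : set R[i]^o) z : open U -> U z -> 0 < depth U z.
Proof.
move=> oU Uz; have /nbhs_complexP[r r0 rU] := open_nbhs_nbhs (conj oU Uz).
apply: (@lt_le_trans _ _ (Num.min r 1)); first by rewrite lt_min r0 ltr01.
apply: ub_le_sup; first by have [] := depth_sup U z.
split; first by rewrite ge_min lexx orbT le_min ltW // ler01.
by move=> w; rewrite lt_min => /andP[/rU].
Qed.

Lemma depth_eq0 (U : set R[i]^o) z : ~ U z -> depth U z = 0.
Proof.
move=> nUz; apply/le_anti; rewrite depth_ge0 andbT.
apply: ge_sup; first by have [] := depth_sup U z.
move=> r [_ rU]; rewrite leNgt; apply/negP => r0; apply: nUz; apply: rU.
by rewrite subrr normc0.
Qed.

Lemma continuous_depth (U : set R[i]^o) : continuous (depth U).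
Proof.
have le_depth z w : depth U z <= depth U w + normc (z - w).
  apply: ge_sup; first by have [] := depth_sup U z.
  move=> r [/andP[r0 r1] rU]; have [rzw|zwr] := leP r (normc (z - w)).
    by rewrite (le_trans rzw) // lerDr depth_ge0.
  rewrite -lerBlDr; apply: ub_le_sup; first by have [] := depth_sup U w.
  split; first by rewrite subr_ge0 ltW //= lerBlDr (le_trans r1) // lerDl normc_ge0.
  move=> x wx; apply: rU; rewrite -(subrK w z) -addrA.
  by apply: le_lt_trans (le_normcD _ _) _; lra.
apply: lipschitz_continuous_complex => z w.
have := le_depth z w; have := le_depth w z.
by rewrite ler_norml (normcB w z) => h1 h2; apply/andP; split; lra.
Qed.

(** For an open set [U] the functions [(1 - depth U)^k] decrease to the indicator
    of its complement, and the open sets generate the Borel sets. *)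
Lemma measure_eq_of_mean (mu nu : probability (borelC R) R) :
  mu T = 1%E -> nu T = 1%E ->
  (forall f : R[i]^o -> R, {within T, continuous f} -> mean mu f = mean nu f) ->
  forall A : set (borelC R), measurable A -> mu A = nu A.
Proof.
move=> muT nuT mean_eq.
have mT := @measurable_circle R.
pose f (U : set R[i]^o) k (z : R[i]^o) : R := (1 - depth U z) ^+ k.
have cf U k : {within T, continuous (f U k)}.
  apply: continuous_subspaceT => z; rewrite /f.
  apply: (@cvg_comp _ _ _ (fun z => 1 - depth U z) (fun x : R => x ^+ k) _
    (nbhs (1 - depth U z))); last exact: exprn_continuous.
  exact: (cvgB (cvg_cst _) (@continuous_depth U z)).
have lim (m : probability (borelC R) R) (mT1 : m T = 1%E) (U : set (borelC R)) :
    open (U : set R[i]^o) -> (mean m (f U k))%:E @[k --> \oo] --> m (T `\` U).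
  move=> oU.
  have mU : measurable U by exact: sub_sigma_algebra.
  have -> : m (T `\` U) = (\int[m]_(z in (T : set (borelC R))) (\1_(~` U) z)%:E)%E.
    by rewrite integral_indic ?setDE 1?setIC //; exact: measurableC.
  have e k : ((mean m (f U k))%:E =
      \int[m]_(z in (T : set (borelC R))) (f U k z)%:E)%E.
    by rewrite (meanE mT1 (cf U k)).
  under eq_fun do rewrite e.
  apply: (@dominated_cvg _ _ _ m T mT (fun k z => (f U k z)%:E) _ (fun=> 1%E)) => //.
  - move=> k; apply/measurable_EFinP; exact: circle_continuous_measurable.
  - move=> z Tz; apply: cvg_EFin; first exact: nearW.
    rewrite /comp /= /f indicE.
    have d0 := depth_ge0 U z; have d1 := depth_le1 U z.
    case: (pselect (U z)) => Uz.
      rewrite memNset; last by move=> /(_ Uz).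
      apply: cvg_expr; have := depth_gt0 oU Uz.
      by rewrite ger0_norm; lra.
    rewrite mem_set // depth_eq0 // subr0.
    by under eq_fun do rewrite expr1n; exact: cvg_cst.
  - have := circle_continuous_integrable mT1 (@circle_continuous_cst R 1).
    by [].
  - move=> k z Tz; rewrite /= lee_fin /f normrX.
    have d0 := depth_ge0 U z; have d1 := depth_le1 U z.
    by rewrite exprn_ile1 // ger0_norm; lra.
have full (m : probability (borelC R) R) (mT1 : m T = 1%E) (U : set (borelC R)) :
    measurable U -> m (~` U) = m (T `\` U).
  move=> mU; have mUc := measurableC mU.
  have -> : m (~` U) = (m (~` U `&` T) + m (~` U `&` ~` T))%E.
    rewrite -measureU //; last 3 first.
    - exact: measurableI.
    - by apply: measurableI => //; exact: measurableC.
    - by rewrite setIACA setICr setI0.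
    by rewrite -setIUr setUCr setIT.
  rewrite [X in (_ + X)%E](_ : _ = 0%E) ?adde0 ?setDE 1?setIC //.
  apply: (@subset_measure0 _ _ _ m _ (~` T)) => //.
  - by apply: measurableI => //; exact: measurableC.
  - exact: measurableC.
  - transitivity (1 - m T)%E; first exact: probability_setC.
    by rewrite mT1 subee.
apply: (@measure_unique _ _ (borelC R) (@open R[i]^o) (fun=> setT) erefl) => //.
- by move=> U V; exact: openI.
- by move=> _; exact: openT.
- by apply/seteqP; split=> // z _; exists 0%N.
- move=> U oU; have mU : measurable (U : set (borelC R)) by exact: sub_sigma_algebra.
  have eC : mu (~` U) = nu (~` U).
    rewrite !full //.
    have h1 := lim _ muT _ oU; have h2 := lim _ nuT _ oU.
    have e : (fun k => (mean mu (f U k))%:E) = (fun k => (mean nu (f U k))%:E).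
      by apply/funext => k; rewrite mean_eq.
    rewrite e in h1.
    exact: (cvg_unique (@ereal_hausdorff R) h1 h2).
  have mUc : measurable (~` U : set (borelC R)) by exact: measurableC.
  rewrite -(setCK U); transitivity (1 - mu (~` U))%E; first exact: probability_setC.
  by rewrite eC; apply/esym; exact: probability_setC.
- by move=> _; rewrite -ge0_fin_numE // fin_num_measure.
Qed.

End measure_determination.

(** * The Poisson kernel measure *)

(** The formula for integrals comes from the Radon-Nikodym derivative, which
    agrees almost everywhere with the given density. *)
Lemma density_probability (R : realType) (d : measure_display)
    (X : measurableType d) (mu : {sigma_finite_measure set X -> \bar R})
    (G : X -> R) :
  (forall x, 0 <= G x) -> mu.-integrable setT (EFin \o G) ->
  (\int[mu]_x (G x)%:E = 1)%E ->
  exists P : probability X R,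
    (forall A, measurable A -> P A = (\int[mu]_(x in A) (G x)%:E)%E) /\
    (forall f : X -> \bar R, P.-integrable setT f ->
       (\int[P]_x f x = \int[mu]_x (f x * (G x)%:E))%E).
Proof.
move=> G0 iG G1.
pose p (A : set X) : \bar R := (\int[mu]_(x in A) (G x)%:E)%E.
have p0 : p set0 = 0%E by rewrite /p integral_set0.
have pge0 A : (0 <= p A)%E by apply: integral_ge0 => x _; rewrite lee_fin.
have padd : semi_sigma_additive p.
  move=> F mF tF mUF; rewrite /p integral_bigcup //=; last first.
    exact: (integrableS measurableT).
  apply: is_cvg_ereal_nneg_natsum_cond => n _ _.
  by apply: integral_ge0 => x _; rewrite lee_fin.
pose pm : {measure set X -> \bar R} := HB.pack p (isMeasure.Build _ _ _ p p0 pge0 padd).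
pose P : probability X R := HB.pack p (isMeasure.Build _ _ _ p p0 pge0 padd)
  (Measure_isProbability.Build _ _ _ pm G1).
exists P; split => // f iF.
have Pmu : (P : {measure set X -> \bar R}) `<< mu.
  apply/null_content_dominatesP => A mA A0.
  apply: null_set_integral => //.
  by apply: measurable_funTS; exact: measurable_int iG.
rewrite -(Radon_Nikodym_change_of_variables Pmu measurableT iF).
have mG : measurable_fun [set: X] (EFin \o G) := measurable_int _ iG.
have mf : measurable_fun [set: X] f := measurable_int _ iF.
pose nu := charge_of_finite_measure P.
have iRN : mu.-integrable [set: X] (Radon_Nikodym nu mu).
  exact: Radon_Nikodym_integrable.
have mRN : measurable_fun [set: X] (Radon_Nikodym nu mu) := measurable_int _ iRN.
apply: ae_eq_integral => //; [exact: emeasurable_funM|exact: emeasurable_funM|].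
apply: ae_eqe_mul2l; apply: integral_ae_eq => // E _ mE.
by rewrite -Radon_Nikodym_integral.
Qed.

Section poisson.
Variable R : realType.
Notation leb := (@lebesgue_measure R).

Lemma ftc_period (F f : R -> R) :
  (forall t : R, is_derive t 1 F (f t)) -> continuous f ->
  (\int[leb]_(t in `[0%R, (2 * pi)%R[) (f t)%:E = (F (2 * pi) - F 0)%:E)%E.
Proof.
move=> dF cf.
have p0 : 0 < 2 * pi :> R by rewrite mulr_gt0 // pi_gt0.
have cF t : {for t, continuous F}.
  by apply/differentiable_continuous/derivable1_diffP; have [] := dF t.
rewrite integral_itv_bndo_bndc; last first.
  by apply/measurable_EFinP/measurable_funTS; exact: continuous_measurable_fun.
rewrite (@continuous_FTC2 _ f F) // ?EFinB //.
- exact: continuous_subspaceT.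
- split.
  + by move=> t _; have [] := dF t.
  + by apply: cvg_at_right_filter; exact: cF.
  + by apply: cvg_at_left_filter; exact: cF.
- by move=> t _; rewrite derive1E; have [] := dF t.
Qed.

(** For [|b| < 1] this is the Poisson kernel of the unit disc at [b], normalized
    to mass 1; for [|b| > 1] it is the one at [1 / b]. *)
Definition poisson_density (b t : R) : R :=
  `|1 - b ^+ 2| / (2 * pi * (1 - 2 * b * cos t + b ^+ 2)).

(** The primitive is [t - 2 arg (1 - c e^(it))]. It is continuous on the whole
    line because [1 - c e^(it)] stays in the right half-plane. *)
Lemma is_derive_poisson_primitive (c t : R) : `|c| < 1 ->
  is_derive t 1 (fun t : R => t + 2 * atan (c * sin t / (1 - c * cos t)))
    ((1 - c ^+ 2) / (1 - 2 * c * cos t + c ^+ 2)).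
Proof.
move=> c1.
have d0 : 1 - c * cos t != 0.
  rewrite gt_eqF // subr_gt0; apply: le_lt_trans (ler_norm _) _.
  apply: le_lt_trans c1; rewrite normrM ler_piMr //.
  by rewrite ler_norml cos_geN1 cos_le1.
have s2 : sin t ^+ 2 = 1 - cos t ^+ 2 by rewrite -(cos2Dsin2 t); ring.
have D0 : 1 - 2 * c * cos t + c ^+ 2 != 0.
  have -> : 1 - 2 * c * cos t + c ^+ 2 = (1 - c * cos t) ^+ 2 + (c * sin t) ^+ 2.
    by ring: s2.
  by rewrite gt_eqF // ltr_wpDr ?sqr_ge0 // exprn_even_gt0.
have du : is_derive t 1 (fun s : R => c * sin s) (c * cos t).
  exact: is_derive_eq.
have dv : is_derive t 1 (fun s : R => 1 - c * cos s) (c * sin t).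
  by apply: is_derive_eq; rewrite /GRing.scale /=; ring.
have dq : is_derive t 1 (fun s : R => c * sin s / (1 - c * cos s)) _ :=
  is_deriveM du (@is_deriveV R (fun s => 1 - c * cos s) t _ 1 d0 dv).
have da := @is_derive1_comp _ atan (fun s : R => c * sin s / (1 - c * cos s))
  t _ _ (is_derive1_atan _) dq.
have dF := is_deriveD (is_derive_id t 1) (is_deriveZ 2 da).
apply: is_derive_eq dF _; rewrite /GRing.scale /=.
have q0 : 1 + (c * sin t / (1 - c * cos t)) ^+ 2 != 0.
  by rewrite gt_eqF // ltr_wpDr ?sqr_ge0.
have -> : (1 + (c * sin t / (1 - c * cos t)) ^+ 2)^-1 =
    (1 - c * cos t) ^+ 2 / (1 - 2 * c * cos t + c ^+ 2).
  apply: (mulfI q0); rewrite divff // mulrA.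
  have -> : (1 + (c * sin t / (1 - c * cos t)) ^+ 2) * (1 - c * cos t) ^+ 2 =
      1 - 2 * c * cos t + c ^+ 2.
    rewrite mulrDl mul1r -exprMn divfK // exprMn; ring: s2.
  by rewrite divff.
by field: s2; rewrite D0 d0.
Qed.

Variable b : R.
Hypotheses (hb1 : b != 1) (hbN1 : b != -1).

Lemma poisson_denom_gt0 t : 0 < 1 - 2 * b * cos t + b ^+ 2.
Proof.
have -> : 1 - 2 * b * cos t + b ^+ 2 = normc (expi t - b%:C) ^+ 2.
  have s2 : sin t ^+ 2 = 1 - cos t ^+ 2 by rewrite -(cos2Dsin2 t); ring.
  by rewrite sqr_normc /=; ring: s2.
by rewrite exprn_gt0 // normc_gt0 circle_neq_real // normc_expi.
Qed.

Lemma poisson_density_ge0 t : 0 <= poisson_density b t.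
Proof.
rewrite /poisson_density divr_ge0 // mulr_ge0 // ?mulr_ge0 ?pi_ge0 //.
exact/ltW/poisson_denom_gt0.
Qed.

Lemma continuous_poisson_density : continuous (poisson_density b).
Proof.
move=> t; apply: cvgM; first exact: cvg_cst.
apply: cvgV.
  by rewrite mulf_neq0 ?mulf_neq0 ?(gt_eqF (pi_gt0 R)) ?(gt_eqF (poisson_denom_gt0 t)).
apply: cvgM; first exact: cvg_cst.
apply: cvgD; last exact: cvg_cst.
apply: cvgB; first exact: cvg_cst.
apply: cvgM; first exact: cvg_cst.
exact: continuous_cos.
Qed.

(** The density is invariant under [b |-> 1 / b], which reduces the mass to the
    case of a point inside the disc. *)
Lemma poisson_density_inner : exists2 c, `|c| < 1 &
  forall t, poisson_density b t =
    (2 * pi)^-1 * ((1 - c ^+ 2) / (1 - 2 * c * cos t + c ^+ 2)).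
Proof.
have D0 := poisson_denom_gt0; rewrite /poisson_density.
have : pi != 0 :> R by rewrite gt_eqF // pi_gt0.
move: (@pi R) => p p0.
have [bl|bg|be] := ltgtP `|b| 1.
- exists b => // t; rewrite ger0_norm.
    by field; rewrite p0 gt_eqF.
  by rewrite subr_ge0 -real_normK ?num_real // expr_le1 // ltW.
- have b0 : b != 0 by apply: contraTneq bg => ->; rewrite normr0 ltr10.
  exists b^-1; first by rewrite normfV invf_lt1 // normr_gt0.
  move=> t; rewrite ler0_norm; last first.
    by rewrite subr_le0 -real_normK ?num_real // expr_ge1 // ltW.
  have -> : 1 - 2 * b^-1 * cos t + b^-1 ^+ 2 = (1 - 2 * b * cos t + b ^+ 2) / b ^+ 2.
    by field.
  by field; rewrite b0 p0 gt_eqF.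
- move: be => /eqP; rewrite eqr_norml ler01 andbT.
  by rewrite (negbTE hb1) (negbTE hbN1).
Qed.

Lemma integral_poisson_density :
  (\int[leb]_(t in `[0%R, (2 * pi)%R[) (poisson_density b t)%:E = 1)%E.
Proof.
have [c c1 dE] := poisson_density_inner.
have p0 := pi_gt0 R.
have dF t := is_deriveZ (2 * pi)^-1 (is_derive_poisson_primitive t c1).
have cd : continuous
    (fun t => (2 * pi)^-1 * ((1 - c ^+ 2) / (1 - 2 * c * cos t + c ^+ 2))).
  by rewrite -(funext dE); exact: continuous_poisson_density.
under eq_integral do rewrite dE.
rewrite (ftc_period dF cd) /= /GRing.scale /=.
rewrite sin0 (mulr_natl pi 2) sin2pi !mulr0 !mul0r atan0 mulr0 !addr0 mulr0 subr0.
by rewrite mulVf // gt_eqF // mulrn_wgt0.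
Qed.

Lemma mobius_expiE t : mobius b (expi t) =
  ((2 * b - (1 + b ^+ 2) * cos t) / (1 - 2 * b * cos t + b ^+ 2)) +i*
  ((1 - b ^+ 2) * sin t / (1 - 2 * b * cos t + b ^+ 2)).
Proof.
have s2 : sin t ^+ 2 = 1 - cos t ^+ 2 by rewrite -(cos2Dsin2 t); ring.
have D0 := lt0r_neq0 (poisson_denom_gt0 t).
have zb := circle_neq_real hb1 hbN1 (normc_expi t).
apply: (mulIf zb); rewrite /mobius divfK //.
apply: complex_eqP; rewrite ReM || rewrite ImM; rewrite /= ; field: s2; exact: D0.
Qed.

(** On the circle [mobius b] turns with angular velocity
    [- (1 - b^2) / |e^(it) - b|^2]. *)
Definition mobius_speed t : R := - (1 - b ^+ 2) / (1 - 2 * b * cos t + b ^+ 2).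

Lemma is_derive_mobius (t : R) :
  is_derive t 1 (fun t => Re (mobius b (expi t)))
    (- mobius_speed t * Im (mobius b (expi t))) /\
  is_derive t 1 (fun t => Im (mobius b (expi t)))
    (mobius_speed t * Re (mobius b (expi t))).
Proof.
have s2 : sin t ^+ 2 = 1 - cos t ^+ 2 by rewrite -(cos2Dsin2 t); ring.
have D0 := lt0r_neq0 (poisson_denom_gt0 t).
have dD : is_derive t 1 (fun s : R => 1 - 2 * b * cos s + b ^+ 2) (2 * b * sin t).
  by apply: is_derive_eq; rewrite /GRing.scale /=; ring.
have dV := @is_deriveV R (fun s => 1 - 2 * b * cos s + b ^+ 2) t _ 1 D0 dD.
have dc : is_derive t 1 (fun s : R => 2 * b - (1 + b ^+ 2) * cos s)
    ((1 + b ^+ 2) * sin t).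
  by apply: is_derive_eq; rewrite /GRing.scale /=; ring.
have ds : is_derive t 1 (fun s : R => (1 - b ^+ 2) * sin s) ((1 - b ^+ 2) * cos t).
  exact: is_derive_eq.
rewrite mobius_expiE /mobius_speed /=; split.
- have -> : (fun t => Re (mobius b (expi t))) =
      (fun s : R => 2 * b - (1 + b ^+ 2) * cos s) *
      (fun s : R => (1 - 2 * b * cos s + b ^+ 2)^-1).
    by apply/funext => s; rewrite mobius_expiE.
  apply: is_derive_eq (is_deriveM dc dV) _.
  by rewrite /GRing.scale /=; field: s2; exact: D0.
- have -> : (fun t => Im (mobius b (expi t))) =
      (fun s : R => (1 - b ^+ 2) * sin s) *
      (fun s : R => (1 - 2 * b * cos s + b ^+ 2)^-1).
    by apply/funext => s; rewrite mobius_expiE.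
  apply: is_derive_eq (is_deriveM ds dV) _.
  by rewrite /GRing.scale /=; field: s2; exact: D0.
Qed.

Lemma is_derive_mobiusX k (t : R) :
  is_derive t 1 (fun t => Re (mobius b (expi t) ^+ k))
    (- (k%:R * mobius_speed t) * Im (mobius b (expi t) ^+ k)) /\
  is_derive t 1 (fun t => Im (mobius b (expi t) ^+ k))
    (k%:R * mobius_speed t * Re (mobius b (expi t) ^+ k)).
Proof.
have [dX dY] := is_derive_mobius t.
elim: k => [|k [IHr IHi]].
  rewrite !mul0r oppr0 mul0r; split.
    by have := is_derive_cst (1 : R) t (1 : R).
  by have := is_derive_cst (0 : R) t (1 : R).
split.
- have -> : (fun t => Re (mobius b (expi t) ^+ k.+1)) =
      (fun t => Re (mobius b (expi t))) * (fun t => Re (mobius b (expi t) ^+ k)) -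
      (fun t => Im (mobius b (expi t))) * (fun t => Im (mobius b (expi t) ^+ k)).
    by apply/funext => s; rewrite exprS ReM.
  apply: is_derive_eq (is_deriveB (is_deriveM dX IHr) (is_deriveM dY IHi)) _.
  by rewrite [in RHS]exprS ImM -(natr1 k) /GRing.scale /=; ring.
- have -> : (fun t => Im (mobius b (expi t) ^+ k.+1)) =
      (fun t => Re (mobius b (expi t))) * (fun t => Im (mobius b (expi t) ^+ k)) +
      (fun t => Im (mobius b (expi t))) * (fun t => Re (mobius b (expi t) ^+ k)).
    by apply/funext => s; rewrite exprS ImM.
  apply: is_derive_eq (is_deriveD (is_deriveM dX IHi) (is_deriveM dY IHr)) _.
  by rewrite [in RHS]exprS ReM -(natr1 k) /GRing.scale /=; ring.
Qed.

Lemma poisson_densityE t : poisson_density b t =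
  - (`|1 - b ^+ 2| / (1 - b ^+ 2) / (2 * pi)) * mobius_speed t.
Proof.
have D0 := lt0r_neq0 (poisson_denom_gt0 t); have b0 := one_sub_sqr_neq0 hb1 hbN1.
rewrite /poisson_density /mobius_speed.
have : pi != 0 :> R by rewrite gt_eqF // pi_gt0.
by move: (@pi R) => p p0; field; rewrite D0 b0 p0.
Qed.

Lemma continuous_mobius_expiX k :
  continuous (fun t : R => Re (mobius b (expi t) ^+ k)) /\
  continuous (fun t : R => Im (mobius b (expi t) ^+ k)).
Proof.
split=> t; apply/differentiable_continuous/derivable1_diffP.
  by have [[]] := is_derive_mobiusX k t.
by have [_ []] := is_derive_mobiusX k t.
Qed.

Lemma expi_period : expi (2 * pi) = expi 0 :> R[i].
Proof. by rewrite /expi (mulr_natl pi 2) cos2pi sin2pi cos0 sin0. Qed.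

(** Up to a constant factor the density is the angular velocity of [mobius b], so
    that its product with a power of [mobius b] is the derivative of a periodic
    function. *)
Lemma integral_poisson_moment k :
  (\int[leb]_(t in `[0%R, (2 * pi)%R[)
      (Re (mobius b (expi t) ^+ k.+1) * poisson_density b t)%:E = 0)%E /\
  (\int[leb]_(t in `[0%R, (2 * pi)%R[)
      (Im (mobius b (expi t) ^+ k.+1) * poisson_density b t)%:E = 0)%E.
Proof.
have [cr ci] := continuous_mobius_expiX k.+1; have cp := continuous_poisson_density.
pose C := - (`|1 - b ^+ 2| / (1 - b ^+ 2) / (2 * pi)) / k.+1%:R.
split.
- have dF (t : R) : is_derive t 1 (C \*: (fun t => Im (mobius b (expi t) ^+ k.+1)))
      (Re (mobius b (expi t) ^+ k.+1) * poisson_density b t).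
    apply: is_derive_eq (is_deriveZ C (is_derive_mobiusX k.+1 t).2) _.
    by rewrite poisson_densityE /C /GRing.scale /=; move: (_ / (2 * pi)) => c; field.
  rewrite (ftc_period dF); first by rewrite /= expi_period subrr.
  by move=> t; apply: cvgM; [exact: cr|exact: cp].
- have dF (t : R) : is_derive t 1 ((- C) \*: (fun t => Re (mobius b (expi t) ^+ k.+1)))
      (Im (mobius b (expi t) ^+ k.+1) * poisson_density b t).
    apply: is_derive_eq (is_deriveZ (- C) (is_derive_mobiusX k.+1 t).1) _.
    by rewrite poisson_densityE /C /GRing.scale /=; move: (_ / (2 * pi)) => c; field.
  rewrite (ftc_period dF); first by rewrite /= expi_period subrr.
  by move=> t; apply: cvgM; [exact: ci|exact: cp].
Qed.

End poisson.

Section poisson_measure.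
Variables (R : realType) (b : R).
Hypotheses (hb1 : b != 1) (hbN1 : b != -1).
Notation leb := (@lebesgue_measure R).
Notation T := (@unit_circle R).

Lemma measurable_expi : @measurable_fun _ _ (measurableTypeR R) (borelC R) setT (@expi R).
Proof.
apply: (@measurability _ _ (measurableTypeR R) (borelC R) setT _
  (@open R[i]^o) erefl) => _ [U oU <-].
rewrite setTI; apply: open_measurable.
by have /continuousP := @continuous_expi R; apply.
Qed.

Lemma mobius_continuous_circle : {within T, continuous (mobius b : R[i]^o -> R[i]^o)}.
Proof.
apply: continuous_in_subspaceT => z /set_mem z1.
have zb := circle_neq_real hb1 hbN1 z1.
have cid : (fun z : R[i]^o => z) @ (z : R[i]^o) --> (z : R[i]^o) by exact: cvg_id.
have cnum : (fun z : R[i]^o => (b%:C : R[i]^o) * z - (1 : R[i]^o)) @ (z : R[i]^o) -->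
    ((b%:C : R[i]^o) * (z : R[i]^o) - (1 : R[i]^o)).
  exact: (cvgB (cvgM (cvg_cst _) cid) (cvg_cst _)).
have cden : (fun z : R[i]^o => z - (b%:C : R[i]^o)) @ (z : R[i]^o) -->
    ((z : R[i]^o) - (b%:C : R[i]^o)).
  exact: (cvgB cid (cvg_cst _)).
exact: cvgM cnum (cvgV zb cden).
Qed.

Lemma poisson_measure_exists : exists mu : probability (borelC R) R,
  [/\ has_angular_density mu (poisson_density b), mu T = 1%E,
      forall m, cos_moment (mobius b) mu m.+1 = 0 &
      forall m, sin_moment (mobius b) mu m.+1 = 0].
Proof.
set I := `[0%R, (2 * pi)%R[%classic : set R.
have mI : measurable I by exact: measurable_itv.
pose G := (poisson_density b) \_ I.
have G0 t : 0 <= G t by rewrite /G patchE; case: ifP => // _; exact: poisson_density_ge0.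
have mg : measurable_fun setT (poisson_density b).
  exact: continuous_measurable_fun (continuous_poisson_density hb1 hbN1).
have GE : EFin \o G = (EFin \o poisson_density b) \_ I by rewrite restrict_EFin.
have intG : (\int[leb]_t (G t)%:E = 1)%E.
  rewrite -(integral_poisson_density hb1 hbN1) [RHS]integral_mkcond.
  by apply: eq_integral => t _; rewrite -[LHS]/((EFin \o G) t) GE.
have iG : leb.-integrable setT (EFin \o G).
  apply/integrableP; split.
    rewrite GE; apply/(measurable_restrictT _ _).1 => //.
    by apply/measurable_funTS/measurable_EFinP.
  have -> : (\int[leb]_t `|(EFin \o G) t| = \int[leb]_t (G t)%:E)%E.
    by apply: eq_integral => t _; rewrite gee0_abs // lee_fin.
  by rewrite intG ltry.
have [P [PE Pint]] := @density_probability R _ (measurableTypeR R) leb G G0 iG intG.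
pose X : {mfun (measurableTypeR R) >-> borelC R} := HB.pack (@expi R)
  (isMeasurableFun.Build _ _ (measurableTypeR R) (borelC R) (@expi R) measurable_expi).
pose mu : probability (borelC R) R := distribution P X.
have muT : mu T = 1%E.
  rewrite -(@probability_setT _ _ _ P) /mu /= /distribution /pushforward.
  by congr (P _); apply/seteqP; split=> t //= _; exact: normc_expi.
have moment (f : R[i]^o -> R) : {within T, continuous f} ->
    ((mean mu f)%:E = \int[leb]_(t in I) (f (expi t) * poisson_density b t)%:E)%E.
  move=> cf; have mT := @measurable_circle R.
  have mfT : @measurable_fun _ _ (borelC R) (\bar R) setT ((EFin \o f) \_ T).
    apply: (@measurable_restrictT _ _ (borelC R) (\bar R) T (EFin \o f) mT).1.
    have mf := circle_continuous_measurable cf.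
    exact/measurable_EFinP.
  have fT t : ((EFin \o f) \_ T) (expi t) = (f (expi t))%:E.
    by rewrite patchE mem_set //=; exact: normc_expi.
  have mfe : measurable_fun setT (((EFin \o f) \_ T) \o @expi R).
    exact: measurableT_comp mfT measurable_expi.
  have [M M0 fM] := circle_continuous_bounded cf.
  have iP : P.-integrable setT (((EFin \o f) \_ T) \o @expi R).
    have -> : ((EFin \o f) \_ T) \o @expi R = EFin \o (fun t => f (expi t)).
      by apply/funext => t /=; rewrite fT.
    apply: measurable_bounded_integrable => //.
    - by rewrite -ge0_fin_numE // fin_num_measure.
    - apply/measurable_EFinP; rewrite (_ : _ \o _ = ((EFin \o f) \_ T) \o @expi R) //.
      by apply/funext => t /=; rewrite fT.
    - exists M; split; first by rewrite num_real.
      move=> x Mx t _ /=; apply: le_trans (ltW Mx); apply: fM; exact: normc_expi.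
  rewrite -(meanE muT cf) integral_mkcond.
  rewrite (integral_distribution (X := X) mfT iP) (Pint _ iP).
  rewrite [RHS]integral_mkcond; apply: eq_integral => t _.
  rewrite /= fT -EFinM /G /patch; case: ifP => // _.
  by rewrite mulr0.
exists mu; split.
- move=> A mA.
  have mE : measurable ((@expi R : measurableTypeR R -> borelC R) @^-1` A).
    by rewrite -[X in measurable X]setTI; apply: measurable_expi.
  transitivity (\int[leb]_(t in (@expi R) @^-1` A) (G t)%:E)%E; first exact: PE mE.
  rewrite setIC [RHS]integral_mkcondr; apply: eq_integral => t _.
  by rewrite -[LHS]/((EFin \o G) t) GE.
- exact: muT.
- move=> m; have [cr _] := circle_continuous_moment mobius_continuous_circle m.+1.
  by apply: EFin_inj; rewrite moment // (integral_poisson_moment hb1 hbN1 m).1.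
- move=> m; have [_ ci] := circle_continuous_moment mobius_continuous_circle m.+1.
  by apply: EFin_inj; rewrite moment // (integral_poisson_moment hb1 hbN1 m).2.
Qed.

End poisson_measure.

(** * Discrete energy *)

Section pair_products.
Variable R : realType.

Lemma prod_off_diagonal n (f : 'I_n -> 'I_n -> R) :
  (forall j k, f j k = f k j) ->
  \prod_(j < n) \prod_(k < n | k != j) f j k =
  (\prod_(j < n) \prod_(k < n | (j < k)%N) f j k) ^+ 2.
Proof.
move=> fC.
have -> : \prod_(j < n) \prod_(k < n | k != j) f j k =
    \prod_(j < n) ((\prod_(k < n | (j < k)%N) f j k) *
                   (\prod_(k < n | (k < j)%N) f j k)).
  apply: eq_bigr => j _; rewrite (bigID (fun k : 'I_n => (j < k)%N)) /=.
  by congr (_ * _); apply: eq_bigl => k; rewrite -(inj_eq val_inj) /=; case: ltngtP.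
rewrite big_split /= expr2; congr (_ * _).
rewrite (exchange_big_dep predT) //=.
by apply: eq_bigr => j _; apply: eq_bigr => k _; rewrite fC.
Qed.

Lemma ln_prod (I : Type) (s : seq I) (P : pred I) (F : I -> R) :
  (forall i, P i -> 0 < F i) ->
  0 < \prod_(i <- s | P i) F i /\
  ln (\prod_(i <- s | P i) F i) = \sum_(i <- s | P i) ln (F i).
Proof.
move=> F0; elim: s => [|i s [p0 pE]]; first by rewrite !big_nil ln1.
rewrite !big_cons; case: ifP => // Pi.
by rewrite mulr_gt0 ?F0 // lnM ?posrE ?F0 // pE.
Qed.

(** Both sides are the derivative of [X^n - 1] at the root [w^j]. *)
Lemma prod_root_powersB (K : fieldType) n (w : K) (j : 'I_n) :
  n.-primitive_root w ->
  \prod_(k < n | k != j) (w ^+ j - w ^+ k) = (w ^+ j) ^+ n.-1 *+ n.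
Proof.
move=> wP; have := factor_Xn_sub_1 wP; rewrite big_mkord (bigD1 j) //=.
move=> /(congr1 (fun p : {poly K} => (deriv p).[w ^+ j])).
rewrite derivM derivXsubC mul1r derivB derivXn derivC subr0.
rewrite hornerD hornerM hornerXsubC subrr mul0r addr0 horner_prod.
rewrite hornerMn hornerXn => <-.
by apply: eq_bigr => k _; rewrite hornerXsubC.
Qed.

(** The square of this product is [n^n], the discriminant of [X^n - 1] up to
    sign. *)
Lemma root_powers_product n (w : R[i]) : n.-primitive_root w -> normc w = 1 ->
  \prod_(j < n) \prod_(k < n | (j < k)%N) normc (w ^+ j - w ^+ k) >= 1.
Proof.
move=> wP w1; have n0 := prim_order_gt0 wP.
have col (j : 'I_n) : \prod_(k < n | k != j) normc (w ^+ j - w ^+ k) = n%:R.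
  rewrite -(big_morph (@normc R) (@normcM R) (@normc1 R)) prod_root_powersB //.
  rewrite -mulr_natr normcM !normcX w1 !expr1n mul1r.
  by rewrite -(rmorph_nat (real_complex R)) normc_real ger0_norm.
rewrite -(@expr_ge1 _ 2) //; last first.
  by apply: prodr_ge0 => j _; apply: prodr_ge0 => k _; exact: normc_ge0.
rewrite -(@prod_off_diagonal n (fun j k => normc (w ^+ j - w ^+ k))); last first.
  by move=> j k; rewrite normcB.
under eq_bigr do rewrite col.
by rewrite prodr_const card_ord -natrX ler1n expn_gt0 n0.
Qed.

End pair_products.

Section discrete_energy.
Variables (R : realType) (n : nat) (u : 'I_n -> R[i]).
Hypothesis u1 : forall j, normc (u j) = 1.
Hypothesis u_inj : forall j k, j != k -> u j != u k.
Hypothesis u_large : 1 <= \prod_(j < n) \prod_(k < n | (j < k)%N) normc (u j - u k).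

Lemma sum_ln_dist_ge0 : 0 <= \sum_(j < n) \sum_(k < n | k != j) ln (normc (u j - u k)).
Proof.
have d0 j k : k != j -> 0 < normc (u j - u k).
  by move=> kj; rewrite normc_gt0 subr_eq0 u_inj // eq_sym.
have rowE j := ln_prod (index_enum 'I_n) (fun k kj => d0 j k kj).
have [_ allE] := @ln_prod R _ (index_enum 'I_n) predT
  (fun j => \prod_(k < n | k != j) normc (u j - u k)) (fun j _ => (rowE j).1).
under eq_bigr do rewrite -(rowE _).2.
rewrite -allE ln_ge0 // (@prod_off_diagonal R n (fun j k => normc (u j - u k))).
  by rewrite exprn_ege1.
by move=> j k; rewrite normcB.
Qed.

Lemma sum_powers_dist (r : R) K :
  \sum_(j < n) \sum_(k < n) \sum_(i < K)
      r ^+ i.+1 / i.+1%:R * Re ((u j * (u k)^*%C) ^+ i.+1) =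
  \sum_(i < K) r ^+ i.+1 / i.+1%:R *
      ((\sum_(j < n) Re (u j ^+ i.+1)) ^+ 2 + (\sum_(j < n) Im (u j ^+ i.+1)) ^+ 2).
Proof.
under eq_bigr do rewrite exchange_big /=.
rewrite exchange_big /=; apply: eq_bigr => i _.
under eq_bigr do rewrite -mulr_sumr.
rewrite -mulr_sumr; congr (_ * _).
rewrite !expr2 !big_distrlr /= -big_split /=; apply: eq_bigr => j _.
rewrite -big_split /=; apply: eq_bigr => k _.
by rewrite exprMn -conjcX ReM Re_conj Im_conj; ring.
Qed.

(** The kernel is expanded as for the continuous energy. The diagonal terms,
    absent from the discrete energy, cost [- n ln (1 - r)], which is negligible
    against [n^2]. *)
Lemma discrete_moment_bound m (r : R) : 0 < r -> r < 1 ->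
  r ^+ m.+1 / m.+1%:R *
    ((\sum_(j < n) Re (u j ^+ m.+1)) ^+ 2 + (\sum_(j < n) Im (u j ^+ m.+1)) ^+ 2)
  <= n%:R ^+ 2 * (- (2^-1 * ln r)) + n%:R * (- ln (1 - r)).
Proof.
move=> r0 r1.
apply: (@le_of_geometric_error _ _ _ (n%:R ^+ 2 * (r ^+ m.+2 / (1 - r))) r) => [| |K].
- exact: ltW.
- exact: r1.
pose tail := r ^+ (m.+1 + K).+1 / (1 - r).
have -> : n%:R ^+ 2 * (r ^+ m.+2 / (1 - r)) * r ^+ K = n%:R ^+ 2 * tail.
  by rewrite /tail -addSn exprD; ring.
pose S j k := \sum_(i < m.+1 + K) r ^+ i.+1 / i.+1%:R * Re ((u j * (u k)^*%C) ^+ i.+1).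
pose q i := r ^+ i.+1 / i.+1%:R *
      ((\sum_(j < n) Re (u j ^+ i.+1)) ^+ 2 + (\sum_(j < n) Im (u j ^+ i.+1)) ^+ 2).
have qS : q m <= \sum_(j < n) \sum_(k < n) S j k.
  rewrite sum_powers_dist (bigD1 (Ordinal (leq_addr K m.+1))) //= lerDl.
  apply: sumr_ge0 => i _; rewrite mulr_ge0 ?addr_ge0 ?sqr_ge0 //.
  by rewrite divr_ge0 // exprn_ge0 // ltW.
apply: (le_trans qS).
have L0 : 0 <= - (2^-1 * ln r) by rewrite oppr_ge0 pmulr_rle0 // ln_le0 // ltW.
have diag j : S j j <= - ln (1 - r) + tail.
  have v1 : normc (u j * (u j)^*%C) = 1 by rewrite normcM normc_conj u1 mulr1.
  have := log_series_remainder (m.+1 + K) v1 (ltW r0) r1.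
  rewrite -/(S j j) -/tail unit_mul_conj // mulr1.
  rewrite -(rmorph1 (real_complex R)) -(rmorphB (real_complex R)) normc_real.
  rewrite (@gtr0_norm _ (1 - r)) ?subr_gt0 // ler_norml => /andP[+ _].
  by lra.
have offd j k : k != j -> S j k <= - (2^-1 * ln r) + tail - ln (normc (u j - u k)).
  move=> kj; have jk : u j != u k by rewrite u_inj // eq_sym.
  have := ln_dist_lower (m.+1 + K) (u1 j) (u1 k) jk r0 r1.
  by rewrite -/(S j k) -/tail; lra.
apply: (@le_trans _ _ (\sum_(j < n) (\sum_(k < n) (- (2^-1 * ln r) + tail) - ln (1 - r) -
    \sum_(k < n | k != j) ln (normc (u j - u k))))).
  apply: ler_sum => j _; rewrite (bigD1 j) //= (bigD1 (P := predT) j) //=.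
  have : \sum_(k < n | k != j) S j k <=
      \sum_(k < n | k != j) (- (2^-1 * ln r) + tail - ln (normc (u j - u k))).
    by apply: ler_sum => k; exact: offd.
  rewrite sumrB; have := diag j; move: (- (2^-1 * ln r)) L0 => L L0.
  by lra.
have sum_cst (x : R) : \sum_(k < n) x = n%:R * x.
  by rewrite sumr_const card_ord mulr_natl.
rewrite sumrB big_split /= !sum_cst.
have := sum_ln_dist_ge0; set W := \sum_(_ < n) \sum_(_ < n | _) _.
by rewrite expr2; move: (ln (1 - r)) => l W0; lra.
Qed.

End discrete_energy.

(** * Fekete points *)

Section fekete.
Variables (R : realType) (phi : R[i]^o -> R[i]^o) (w : R[i] -> R) (A : R).
Notation T := (@unit_circle R).
Hypothesis cphi : {within T, continuous phi}.
Hypothesis phi1 : forall z, normc z = 1 -> normc (phi z) = 1.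
Hypothesis phiK : forall z, normc z = 1 -> phi (phi z) = z.
Hypothesis A0 : 0 < A.
Hypothesis phi_dist : forall z t, normc z = 1 -> normc t = 1 ->
  normc (phi z - phi t) = A * (normc (z - t) * w z * w t).

Definition weighted_product n (z : n.-tuple R[i]) : R :=
  \prod_(j < n) \prod_(k < n | (j < k)%N)
     (normc (tnth z j - tnth z k) * w (tnth z j) * w (tnth z k)).

Lemma weighted_productE n (z : n.-tuple R[i]) : on_circle z ->
  weighted_product z =
  (\prod_(j < n) \prod_(k < n | (j < k)%N) normc (phi (tnth z j) - phi (tnth z k))) *
  \prod_(j < n) \prod_(k < n | (j < k)%N) A^-1.
Proof.
move=> zT; rewrite -big_split /=; apply: eq_bigr => j _.
rewrite -big_split /=; apply: eq_bigr => k _.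
by rewrite phi_dist ?zT // [A * _]mulrC mulfK // gt_eqF.
Qed.

Lemma weighted_product_ge0 n (z : n.-tuple R[i]) :
  on_circle z -> 0 <= weighted_product z.
Proof.
move=> zT; rewrite weighted_productE // mulr_ge0 //.
  by apply: prodr_ge0 => j _; apply: prodr_ge0 => k _; exact: normc_ge0.
by apply: prodr_ge0 => j _; apply: prodr_ge0 => k _; rewrite invr_ge0 ltW.
Qed.

Lemma fekete_exponent_gt0 n : (2 <= n)%N -> 0 < 2 / (n%:R * (n%:R - 1)) :> R.
Proof.
move=> n2; rewrite divr_gt0 // mulr_gt0 ?ltr0n ?(leq_trans _ n2) //.
by rewrite subr_gt0 ltr1n.
Qed.

Lemma fekete_maximal n (z z' : n.-tuple R[i]) : (2 <= n)%N ->
  is_fekete w z -> on_circle z' -> weighted_product z' <= weighted_product z.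
Proof.
move=> n2 [zT _ zE] z'T; have e0 := fekete_exponent_gt0 n2.
have : fekete_product w z' <= fekete_product w z.
  rewrite zE; apply: ub_le_sup; last by exists z'.
  exists ((\prod_(j < n) \prod_(k < n | (j < k)%N) (2 / A)) `^
      (2 / (n%:R * (n%:R - 1)))) => _ [y /= yT <-].
  have le_b : weighted_product y <= \prod_(j < n) \prod_(k < n | (j < k)%N) (2 / A).
    have f0 (j k : 'I_n) : 0 <= normc (tnth y j - tnth y k) * w (tnth y j) * w (tnth y k).
      by rewrite -(pmulr_rge0 _ A0) -phi_dist ?yT // normc_ge0.
    apply: ler_prod => j _; apply/andP; split; first by apply: prodr_ge0 => k _.
    apply: ler_prod => k _; rewrite f0 /= ler_pdivlMr // mulrC -phi_dist ?yT //.
    by apply: normcB_le_unit; apply: phi1; exact: yT.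
  apply: ge0_ler_powR => //; first exact: ltW.
    by rewrite nnegrE; exact: weighted_product_ge0.
  by rewrite nnegrE (le_trans _ le_b) //; exact: weighted_product_ge0.
apply: contraTT; rewrite -!ltNge => lt_z; apply: gt0_ltr_powR => //.
  by rewrite nnegrE; exact: weighted_product_ge0.
by rewrite nnegrE; exact: weighted_product_ge0.
Qed.

(** The competitor is the image of the roots of unity, whose product of
    distances is at least 1. *)
Lemma fekete_image_large n (z : n.-tuple R[i]) : (2 <= n)%N -> is_fekete w z ->
  1 <= \prod_(j < n) \prod_(k < n | (j < k)%N) normc (phi (tnth z j) - phi (tnth z k)).
Proof.
move=> n2 zF; have [zT _ _] := zF.
have [v vP v1] := @unit_primitive_root R n (leq_trans (isT : 0 < 2)%N n2).
have vj j : normc (v ^+ j) = 1 by rewrite normcX v1 expr1n.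
pose z' : n.-tuple R[i] := [tuple phi (v ^+ j) | j < n].
have z'E j : tnth z' j = phi (v ^+ j) by rewrite tnth_mktuple.
have z'T : on_circle z' by move=> j; rewrite z'E; exact: phi1.
apply: le_trans (root_powers_product vP v1) _.
have := fekete_maximal n2 zF z'T.
rewrite !weighted_productE // ler_pM2r; last first.
  by apply: prodr_gt0 => j _; apply: prodr_gt0 => k _; rewrite invr_gt0.
congr (_ <= _); apply: eq_bigr => j _; apply: eq_bigr => k _.
by rewrite !z'E !phiK.
Qed.

Lemma empirical_circle n (z : n.-tuple R[i]) : (0 < n)%N -> on_circle z ->
  empirical_measure z (T : set (borelC R)) = 1%E.
Proof.
move=> n0 zT; rewrite /empirical_measure /= /mscale /= /msum /=.
under eq_bigr => k _.
  rewrite diracE mem_set; last by rewrite -tnth_nth; exact: zT.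
  over.
rewrite sumEFin sumr_const card_ord -EFinM mulVf //.
by rewrite pnatr_eq0 -lt0n.
Qed.

Lemma mean_empirical n (z : n.-tuple R[i]) (f : R[i]^o -> R) : (0 < n)%N ->
  on_circle z -> {within T, continuous f} ->
  mean (empirical_measure z) f = n%:R^-1 * \sum_(j < n) f (tnth z j).
Proof.
move=> n0 zT cf; have nuT := empirical_circle n0 zT.
have mT := @measurable_circle R.
have nonneg (g : R[i]^o -> R) : {within T, continuous g} ->
    (forall z, normc z = 1 -> 0 <= g z) ->
    mean (empirical_measure z) g = n%:R^-1 * \sum_(j < n) g (tnth z j).
  move=> cg g0; apply: EFin_inj; rewrite -(meanE nuT cg).
  have mg : @measurable_fun _ _ (borelC R) (\bar R) T (EFin \o g).
    by apply/measurable_EFinP; exact: circle_continuous_measurable.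
  rewrite /empirical_measure ge0_integral_mscale //.
  rewrite ge0_integral_measure_sum //.
  rewrite EFinM -sumEFin; congr (_ * _)%E; apply: eq_bigr => j _.
  rewrite integral_dirac // diracE mem_set ?mul1e ?(tnth_nth 0) //.
  by have := zT j; rewrite (tnth_nth 0).
(* adding a constant reduces the general case to nonnegative functions *)
have [M M0 fM] := circle_continuous_bounded cf.
have cM := @circle_continuous_cst R M.
have := nonneg (fun z => f z + M) (circle_continuousD cf cM).
rewrite (meanD nuT cf cM) (mean_cst nuT) big_split /= sumr_const card_ord.
rewrite -[M *+ n]mulr_natl mulrDr mulKf ?pnatr_eq0 -?lt0n // => h.
apply: (addIr M); apply: h => y y1.
by have := fM y y1; rewrite ler_norml => /andP[h _]; rewrite -lerBlDr sub0r.
Qed.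

Lemma fekete_moment_bound n (z : n.-tuple R[i]) m (d : R) :
  (2 <= n)%N -> is_fekete w z -> 0 < d -> d <= 1 ->
  cos_moment phi (empirical_measure z) m.+1 ^+ 2 +
  sin_moment phi (empirical_measure z) m.+1 ^+ 2 <=
  m.+1%:R * expR m.+1%:R * (d + n%:R^-1 * - ln (1 - expR (- d))).
Proof.
move=> n2 zF d0 d1; have [zT zU _] := zF.
have n0 : (0 < n)%N := leq_trans (isT : 0 < 2)%N n2.
have nR : 0 < n%:R :> R by rewrite ltr0n.
have [cr ci] := circle_continuous_moment cphi m.+1.
rewrite /cos_moment /sin_moment !mean_empirical //.
pose u (j : 'I_n) : R[i] := phi (tnth z j).
have u1 j : normc (u j) = 1 by apply: phi1; exact: zT.
have u_inj j k : j != k -> u j != u k.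
  move=> jk; apply: (phi_neq phiK); rewrite ?zT //.
  by apply: contra jk => /eqP /(tuple_uniqP _ zU) ->.
have r1 : expR (- d) < 1 by rewrite expR_lt1 oppr_lt0.
have := discrete_moment_bound u1 u_inj (fekete_image_large n2 zF) m (expR_gt0 (- d)) r1.
rewrite expRK.
set C := \sum_(j < n) _; set S := \sum_(j < n) _ => bound.
apply: (le_of_discounted d1); first by rewrite addr_ge0 ?sqr_ge0.
have -> : (n%:R^-1 * C) ^+ 2 + (n%:R^-1 * S) ^+ 2 = (C ^+ 2 + S ^+ 2) / n%:R ^+ 2.
  by field; rewrite gt_eqF.
rewrite mulrA ler_pdivrMr ?exprn_gt0 //; apply: le_trans bound _.
move: (- ln (1 - _)) => l.
have -> : (d + n%:R^-1 * l) * n%:R ^+ 2 = n%:R ^+ 2 * d + n%:R * l.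
  by field; rewrite gt_eqF.
have : 0 <= n%:R ^+ 2 * d by rewrite mulr_ge0 ?exprn_ge0 // ltW.
by lra.
Qed.

(** In the previous bound the first term is as small as [d], and the second one
    tends to 0 when [n] grows with [d] fixed. *)
Lemma fekete_moments_cvg (zeta : forall n, n.-tuple R[i]) m :
  (forall n, (2 <= n)%N -> is_fekete w (zeta n)) ->
  cos_moment phi (empirical_measure (zeta n)) m.+1 @[n --> \oo] --> (0 : R) /\
  sin_moment phi (empirical_measure (zeta n)) m.+1 @[n --> \oo] --> (0 : R).
Proof.
move=> zF.
suff sq e : 0 < e -> \forall n \near \oo,
    cos_moment phi (empirical_measure (zeta n)) m.+1 ^+ 2 +
    sin_moment phi (empirical_measure (zeta n)) m.+1 ^+ 2 < e ^+ 2.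
  split; apply/cvgr0Pnorm_lt => e e0; apply: filterS (sq e e0) => n h.
    rewrite -(@ltr_pXn2r _ 2) ?nnegrE ?(ltW e0) // real_normK ?num_real //.
    by apply: le_lt_trans h; rewrite lerDl sqr_ge0.
  rewrite -(@ltr_pXn2r _ 2) ?nnegrE ?(ltW e0) // real_normK ?num_real //.
  by apply: le_lt_trans h; rewrite lerDr sqr_ge0.
move=> e0; have e2 : 0 < e ^+ 2 by rewrite exprn_gt0.
(* [d] makes the first term of the bound at most [e^2 / 2]; then [n] the second *)
pose M : R := m.+1%:R * expR m.+1%:R.
have M0 : 0 < M by rewrite mulr_gt0 ?ltr0n ?expR_gt0.
pose d := Num.min 1 (e ^+ 2 / (2 * M)).
have d0 : 0 < d by rewrite lt_min ltr01 divr_gt0 // mulr_gt0.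
have d1 : d <= 1 by rewrite ge_min lexx.
have dM : 2 * M * d <= e ^+ 2.
  by rewrite mulrC -ler_pdivlMr ?mulr_gt0 // ge_min lexx orbT.
pose l := - ln (1 - expR (- d)).
exists (maxn 2 (Num.truncn (2 * M * l / e ^+ 2)).+1) => // n /=.
rewrite geq_max => /andP[n2 nl].
apply: le_lt_trans (fekete_moment_bound m n2 (zF n n2) d0 d1) _.
rewrite -/M -/l mulrDr.
have nR : 0 < n%:R :> R by rewrite ltr0n (leq_trans _ n2).
have : 2 * M * l / e ^+ 2 < n%:R.
  by apply: lt_le_trans (truncnS_gt _) _; rewrite ler_nat.
rewrite ltr_pdivrMr // => h.
have : M * (n%:R^-1 * l) < e ^+ 2 / 2.
  rewrite mulrCA ltr_pdivrMl //; lra.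
by lra.
Qed.

End fekete.

(** * Equilibrium measure, capacity and limit of the Fekete points *)

Theorem theorem4p1 (R : realType) (b : R) (hb1 : b != 1) (hbN1 : b != -1) :
  let w := fun z : R[i] => 1 / normc (z - b%:C) in
  exists mu_w : probability (borelC R) R,
    [/\ is_equilibrium_measure w mu_w,
        has_angular_density mu_w
          (fun t => `|1 - b ^+ 2| /
                    (2 * pi * (1 - 2 * b * cos t + b ^+ 2))),
        weighted_capacity w = (1 / `|1 - b ^+ 2|)%:E &
        forall zeta : forall n : nat, n.-tuple R[i],
          (forall n, (2 <= n)%N -> is_fekete w (zeta n)) ->
          weak_star_cvg (fun n => empirical_measure (zeta n)) mu_w].
Proof.
move=> w.
have [mu [mu_density muT cos0 sin0]] := poisson_measure_exists hb1 hbN1.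
have cphi := mobius_continuous_circle hb1 hbN1.
have phi1 := @normc_mobius R b hb1 hbN1.
have phiK := @mobiusK R b hb1 hbN1.
have A0 : 0 < `|1 - b ^+ 2| by rewrite normr_gt0 one_sub_sqr_neq0.
have phi_dist := @normc_mobiusB R b hb1 hbN1.
have energy_ge (nu : probability (borelC R) R) (nuT : circle_measures nu) :=
  weighted_energy_ge (w := w) cphi phi1 phiK A0 phi_dist nuT.
have mu_energy_le :=
  weighted_energy_le (w := w) cphi phi1 phiK A0 phi_dist muT cos0 sin0.
have robinE : robin_constant w = (ln `|1 - b ^+ 2|)%:E.
  apply/le_anti/andP; split.
    apply: le_trans mu_energy_le.
    by apply: ereal_inf_lbound; exists mu.
  by apply: le_ereal_inf_tmp => _ [nu nuT <-]; exact: energy_ge.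
have mu_energy : weighted_energy w mu = robin_constant w.
  rewrite robinE; apply/le_anti/andP; split; last exact: energy_ge.
  exact: mu_energy_le.
exists mu; split.
- split=> // nu nuT nu_energy; apply: measure_eq_of_mean => // f cf.
  have nu0 m : cos_moment (mobius b) nu m.+1 = 0 /\ sin_moment (mobius b) nu m.+1 = 0.
    apply: (minimizer_moments0 (w := w) cphi phi1 phiK A0 phi_dist nuT).
    by rewrite nu_energy robinE.
  have h : mean nu f @[n --> \oo] --> mean mu f.
    apply: (weyl_criterion cphi phi1 phiK (nu_ := fun=> nu)) => //.
    + by move=> m; rewrite cos0 (nu0 m).1; exact: cvg_cst.
    + by move=> m; rewrite sin0 (nu0 m).2; exact: cvg_cst.
  have h' : mean nu f @[n --> \oo] --> mean nu f by exact: cvg_cst.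
  exact: (cvg_unique (@Rhausdorff R) h' h).
- exact: mu_density.
- rewrite /weighted_capacity robinE /= expRN lnK ?posrE // div1r //.
- move=> zeta zF f cf; rewrite -(cvg_shiftn 2).
  have n2 n : (2 <= n + 2)%N by rewrite leq_addl.
  have zT n : empirical_measure (zeta (n + 2)%N) (@unit_circle R : set (borelC R)) = 1%E.
    apply: empirical_circle; first by rewrite addn2.
    by have [] := zF _ (n2 n).
  have moments m := fekete_moments_cvg cphi phi1 phiK A0 phi_dist m zF.
  rewrite (meanE muT cf).
  pose nu n := empirical_measure (zeta n).
  have e n : (\int[nu (n + 2)%N]_(z in (@unit_circle R : set (borelC R)))
      (f z)%:E = (mean (nu (n + 2)%N) f)%:E)%E.
    by rewrite (meanE (zT n) cf).
  rewrite (funext e); apply: cvg_EFin; first exact: nearW.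
  apply: (weyl_criterion cphi phi1 phiK
    (nu_ := fun n => nu (n + 2)%N)) => // m.
    rewrite cos0 (cvg_shiftn 2 (fun n => cos_moment (mobius b) (nu n) m.+1)).
    by have [] := moments m.
  rewrite sin0 (cvg_shiftn 2 (fun n => sin_moment (mobius b) (nu n) m.+1)).
  by have [] := moments m.
Qed.
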